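(* Let $k\ge0$ be an integer, $\varepsilon>0$, $H>0$, and consider a regular forecasting problem with reference density $\mu_0$. Let $\nu$ be a measure such that the constant-speed $W_2$-geodesic from $\mu_0$ to $\nu$ is regular with a well-defined velocity field $V$ along which the covariant-derivative chain rule holds, and suppose $$\delta:=W_2(\mu_0,\nu)\ \le\ \frac{\varepsilon H^{k+1}}{(k+1)!}.$$ Then there is a curve in $\mathcal C_k(\varepsilon)$ that equals $\mu_0$ for $t\le t_n-H$ and satisfies $\mu_{t_n}=\nu$.
   Context: $\mathcal P_2(\mathbb R^d)$: Borel probability measures on $\mathbb R^d$ with finite second moment, with the 2-Wasserstein distance $W_2$ and its Otto--Benamou--Brenier formal Riemannian structure. An absolutely continuous curve $t\mapsto\mu_t$ has velocity field $v_t=\dot\mu_t$ with $\partial_t\mu_t+\nabla\cdot(\mu_tv_t)=0$; $\nabla_t$ is the covariant derivative of vector fields along the curve (Gigli's second-order calculus, requisite tangent-module regularity assumed), $\|\cdot\|_{\mu_t}$ the $L^2(\mu_t)$ norm. $\mathcal C_k(\varepsilon)$ is the class of absolutely continuous curves (here, on times up to $t_n$) whose velocity field admits covariant derivatives up to order $k$ with $\operatorname{ess\,sup}_t\|\nabla_t^kv_t\|_{\mu_t}\le\varepsilon$. Regular problem: the curves take values in a family $\mathcal F$ of probability densities on a fixed compact convex set $\Omega=[0,1]^d$, bounded in $[c_\ast/2,2C_\ast]$ for fixed $0<c_\ast\le C_\ast<\infty$, such that, with reference density $\mu_0\equiv1\in\mathcal F$: the $W_2$-optimal maps from $\mu_0$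 to members of $\mathcal F$ are sufficiently smooth; the displacement geodesic from $\mu_0$ to each member stays in $\mathcal F$; and every sufficiently small smooth compactly supported potential $\rho$ keeps $(\mathrm{id}+\nabla\rho)_\#\mu_0$ and its displacement interpolation from $\mu_0$ in $\mathcal F$. The measure $\nu$ is a member of $\mathcal F$. *)

(* Defs.v *)
From HB Require Import structures.
From mathcomp Require Import all_boot all_order all_algebra.
From mathcomp Require Import all_classical all_reals all_analysis ess_sup_inf.

Set Implicit Arguments.
Unset Strict Implicit.
Unset Printing Implicit Defensive.
Import Order.TTheory GRing.Theory Num.Theory.
Import numFieldNormedType.Exports.

Local Open Scope classical_set_scope.
Local Open Scope ring_scope.

(* Borel sigma-algebra on R^d = 'rV[R]_d (the library provides the topology of
   matrices but no sigma-algebra). *)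
Fact borel_rV_display : measure_display. Proof. by []. Qed.

Section borel_rV.
Variables (R : realType) (d : nat).
Let G : set (set 'rV[R]_d) := [set A | open A].

HB.instance Definition _ := @isMeasurable.Build borel_rV_display 'rV[R]_d
  <<s G >> (@sigma_algebra0 _ setT G) (@sigma_algebraC _ G)
  (@sigma_algebra_bigcup _ setT G).

End borel_rV.

Section euclidean.
Variables (R : realType) (d : nat).
Implicit Types x y : 'rV[R]_d.

Definition dot x y : R := \sum_i x 0 i * y 0 i.

(* The library norm `|x| on 'rV[R]_d is the sup norm. *)
Definition enorm x : R := Num.sqrt (dot x x).

End euclidean.

Section smooth_functions.
Variables (R : realType) (d : nat).
Implicit Types f : 'rV[R]_d -> R.

Definition pderiv (s : seq 'I_d) f : 'rV[R]_d -> R :=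
  foldr (fun i g => fun x => 'D_(delta_mx 0 i) g x) f s.

Definition class_C (m : nat) f : Prop :=
  forall s : seq 'I_d, (size s <= m)%N ->
    continuous (pderiv s f) /\
    ((size s < m)%N -> forall i x, derivable (pderiv s f) x (delta_mx 0 i)).

Definition fsupport f : set 'rV[R]_d := closure [set x | f x != 0].

Definition test_function f : Prop :=
  (forall m, class_C m f) /\ compact (fsupport f).

Definition grad f (x : 'rV[R]_d) : 'rV[R]_d :=
  \row_i 'D_(delta_mx 0 i) f x.

Definition class_C_map (m : nat) (T : 'rV[R]_d -> 'rV[R]_d) : Prop :=
  forall i, class_C m (fun x => T x 0 i).

End smooth_functions.

Section wasserstein.
Variables (R : realType) (d : nat).
Notation E := 'rV[R]_d.
Notation prob := (probability E R).
Implicit Types (mu nu : prob) (T : E -> E).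

(* Measures are functions on all sets, so they are compared on Borel sets. *)
Definition same_measure mu nu : Prop :=
  forall A : set E, measurable A -> mu A = nu A.

Definition pushes mu T nu : Prop :=
  measurable_fun [set: E] T /\
  forall A : set E, measurable A -> nu A = mu (T @^-1` A).

Definition L2norm mu (u : E -> E) : \bar R :=
  'N[mu]_(2%:E)[EFin \o (fun x => enorm (u x))]%E.

Definition in_L2 mu (u : E -> E) : Prop :=
  measurable_fun [set: E] u /\ (L2norm mu u < +oo)%E.

Definition finite_second_moment mu : Prop := (L2norm mu id < +oo)%E.

Definition coupling mu nu (pi : probability (E * E)%type R) : Prop :=
  forall A : set E, measurable A ->
    pi (fst @^-1` A) = mu A /\ pi (snd @^-1` A) = nu A.

Definition W2 mu nu : \bar R :=
  ereal_inf [set 'N[pi]_(2%:E)[EFin \o (fun z : E * E => enorm (z.1 - z.2)%R)]%E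
              | pi in coupling mu nu].

Definition optimal_map mu nu T : Prop :=
  pushes mu T nu /\ L2norm mu (fun x => T x - x) = W2 mu nu.

Definition interpolation T (s : R) (x : E) : E := (1 - s) *: x + s *: T x.

Definition geodesic (gamma : R -> prob) mu nu : Prop :=
  [/\ same_measure (gamma 0) mu, same_measure (gamma 1) nu &
      forall s t, s \in `[0, 1] -> t \in `[0, 1] ->
        W2 (gamma s) (gamma t) = (`|t - s|%:E * W2 mu nu)%E].

(* Tangent space of P_2(R^d) at mu: L^2(mu)-closure of the gradients of test
   functions. *)
Definition tangent mu (u : E -> E) : Prop :=
  in_L2 mu u /\
  forall e : R, 0 < e -> exists phi, test_function phi /\
    (L2norm mu (fun x => u x - grad phi x)%R < e%:E)%E.

(* w is the orthogonal projection of z on the tangent space at mu. *)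
Definition tangent_projection mu (z w : E -> E) : Prop :=
  tangent mu w /\
  forall phi, test_function phi ->
    \int[mu]_x dot (z x - w x) (grad phi x) = 0.

End wasserstein.

(* Curves and fields along curves are functions of a time t : R of which only
   the values for t in an interval I matter. *)
Section curves.
Variables (R : realType) (d : nat).
Notation E := 'rV[R]_d.
Notation prob := (probability E R).
Notation leb := (@lebesgue_measure R).
Implicit Types (I : interval R) (mu : R -> prob) (v u w : R -> E -> E).
Implicit Types (X : R -> R -> E -> E).

Definition locally_integrable_on I (m : R -> R) : Prop :=
  forall a b, a \in I -> b \in I -> a <= b ->
    leb.-integrable `[a, b] (EFin \o m).

(* (Local) absolute continuity, D s t being the distance between the values at
   s and at t: D s t <= \int_s^t m with m locally integrable. *)
Definition abs_continuous_on I (D : R -> R -> \bar R) : Prop :=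
  exists m : R -> R, locally_integrable_on I m /\
    forall s t, s \in I -> t \in I -> s <= t ->
      (D s t <= \int[leb]_(r in `[s, t]) (m r)%:E)%E.

Definition ac_curve I mu : Prop :=
  (forall t, t \in I -> finite_second_moment (mu t)) /\
  abs_continuous_on I (fun s t => W2 (mu s) (mu t)).

(* Weak form of d/dt mu_t + div (mu_t v_t) = 0. *)
Definition continuity_equation I mu v : Prop :=
  forall phi, test_function phi ->
  forall a b, a \in I -> b \in I -> a <= b ->
    \int[mu b]_x phi x - \int[mu a]_x phi x =
    \int[leb]_(t in `[a, b]) (\int[mu t]_x dot (v t x) (grad phi x)).

Definition velocity_field I mu v : Prop :=
  [/\ measurable_fun ([set` I] `*` [set: E]) (fun p : R * E => v p.1 p.2),
      (forall a b, a \in I -> b \in I -> a <= b ->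
         (\int[leb]_(t in `[a, b]) L2norm (mu t) (v t) < +oo)%E),
      continuity_equation I mu v &
      \forall t \ae leb, t \in I -> tangent (mu t) (v t)].

(* v_t is Lipschitz up to a mu_t-negligible set, with a constant locally
   integrable in time. *)
Definition lipschitz_velocity I mu v : Prop :=
  exists L : R -> R, locally_integrable_on I L /\
    \forall t \ae leb, t \in I -> exists N : set E, (mu t).-negligible N /\
      forall x y, ~ N x -> ~ N y -> enorm (v t x - v t y) <= L t * enorm (x - y).

(* X s t is the flow of v from time s to time t. *)
Definition flow_maps I mu v X : Prop :=
  [/\ (forall s, s \in I -> measurable_fun ([set` I] `*` [set: E])
         (fun p : R * E => X s p.1 p.2)),
      (forall s t, s \in I -> t \in I -> pushes (mu s) (X s t) (mu t)),
      (forall r s t, r \in I -> s \in I -> t \in I ->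
         \forall x \ae mu r, X s t (X r s x) = X r t x) &
      (forall s, s \in I -> \forall x \ae mu s,
         forall t, t \in I -> s <= t -> forall i,
           leb.-integrable `[s, t] (fun r => (v r (X s r x) 0 i)%:E) /\
           X s t x 0 i = x 0 i + \int[leb]_(r in `[s, t]) v r (X s r x) 0 i)].

(* Regular curve in the sense of Gigli, with its velocity field and flow. *)
Definition regular_curve I mu v X : Prop :=
  [/\ ac_curve I mu, velocity_field I mu v,
      lipschitz_velocity I mu v & flow_maps I mu v X].

Definition ac_tangent_field I mu X u : Prop :=
  (forall t, t \in I -> tangent (mu t) (u t)) /\
  abs_continuous_on I
    (fun s t => L2norm (mu s) (fun x => u t (X s t x) - u s x)).

(* z is the L^2(mu_t)-derivative at time t of u pulled back along the flow. *)
Definition total_derivative_at mu X u (t : R) (z : E -> E) : Prop :=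
  in_L2 (mu t) z /\
  (fun h : R => L2norm (mu t)
     (fun x => h^-1 *: (u (t + h) (X t (t + h) x) - u t x) - z x))
    @ 0^' --> 0%E.

(* w = \nabla_t u, as an almost everywhere defined field. *)
Definition covariant_derivative I mu X u w : Prop :=
  ac_tangent_field I mu X u /\
  \forall t \ae leb, t \in I -> exists z,
    total_derivative_at mu X u t z /\ tangent_projection (mu t) z (w t).

(* v is covariantly differentiable along the curve and
   \nabla_t (f(t) v_{sigma(t)}) =
     f'(t) v_{sigma(t)} + f(t) sigma'(t) (\nabla v)_{sigma(t)}
   along every nondecreasing C^1 reparametrization sigma. *)
Definition covariant_chain_rule J mu v X : Prop :=
  (exists w, covariant_derivative J mu X v w) /\
  forall w, covariant_derivative J mu X v w ->
  forall (I : interval R) (sigma f : R -> R),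
    (forall t, derivable sigma t 1) -> continuous (derive1 sigma) ->
    {homo sigma : s t / s <= t} -> (forall t, t \in I -> sigma t \in J) ->
    abs_continuous_on I (fun s t => `|f t - f s|%:E) ->
    covariant_derivative I (mu \o sigma)
      (fun s t => X (sigma s) (sigma t))
      (fun t x => f t *: v (sigma t) x)
      (fun t x => derive1 f t *: v (sigma t) x +
                  (f t * derive1 sigma t) *: w (sigma t) x).

(* The class C_k(eps) of curves on I with values in F; w j is the j-th
   covariant derivative of the velocity w 0. *)
Definition curve_class (F : set prob) I (k : nat) (eps : R) mu : Prop :=
  [/\ (forall t, t \in I -> F (mu t)), ac_curve I mu &
    exists w : nat -> R -> E -> E,
      [/\ velocity_field I mu (w 0%N),
          ((0 < k)%N -> exists X, regular_curve I mu (w 0%N) X /\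
             forall j, (j < k)%N -> covariant_derivative I mu X (w j) (w j.+1)) &
          (ess_sup leb ((fun t => L2norm (mu t) (w k t)) \_ [set` I])
             <= eps%:E)%E]].

End curves.

Section regular_problem.
Variable R : realType.

(* Integral over R^d against Lebesgue measure, as an iterated integral. *)
Fixpoint lebesgue_integral_rV (d : nat) : ('rV[R]_d -> \bar R) -> \bar R :=
  match d with
  | 0%N => fun f => f 0
  | d'.+1 => fun f => (\int[@lebesgue_measure R]_a
      lebesgue_integral_rV (fun x : 'rV[R]_d' =>
        f (row_mx (a%:M : 'rV[R]_1) x : 'rV[R]_(1 + d'))))%E
  end.

Variable d : nat.
Notation E := 'rV[R]_d.
Notation prob := (probability E R).

Definition unit_cube : set E := [set x | forall i, 0 <= x 0 i <= 1].

(* mu has density rho on the unit cube (and no mass outside). *)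
Definition has_density (mu : prob) (rho : E -> R) : Prop :=
  forall A : set E, measurable A ->
    mu A = lebesgue_integral_rV
             ((EFin \o rho) \_ (A `&` unit_cube)).

(* "Sufficiently smooth" is C^m, for T on the closed cube meaning that T is
   mu_0-a.e. the restriction of a C^m map; a potential is "small" when all its
   partial derivatives up to some fixed order r are. *)
Record regular_problem (cs Cs : R) (m : nat) (F : set prob) (mu0 : prob) :
    Prop := RegularProblem {
  rp_constants : 0 < cs <= Cs ;
  rp_density : forall mu, F mu -> exists rho : E -> R,
    [/\ measurable_fun [set: E] rho,
        (forall x, unit_cube x -> cs / 2 <= rho x <= 2 * Cs) &
        has_density mu rho] ;
  rp_ref : F mu0 ;
  rp_ref_density : has_density mu0 (cst 1) ;
  rp_smooth : forall nu, F nu ->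
    exists T, optimal_map mu0 nu T /\ class_C_map m T ;
  rp_geodesic : forall nu, F nu -> forall T, optimal_map mu0 nu T ->
    forall s, s \in `[0, 1] ->
    forall mu, pushes mu0 (interpolation T s) mu -> F mu ;
  rp_potential : exists (r : nat) (eta : R), 0 < eta /\
    forall rho : E -> R,
      test_function rho -> fsupport rho `<=` interior unit_cube ->
      (forall (s : seq 'I_d) x, (size s <= r)%N -> `|pderiv s rho x| <= eta) ->
    forall s, s \in `[0, 1] ->
    forall mu, pushes mu0 (interpolation (fun x => x + grad rho x) s) mu -> F mu
}.

End regular_problem.

(* Main.v *)
Require Import Defs.
From HB Require Import structures.
From mathcomp Require Import all_boot all_order all_algebra.
From mathcomp Require Import all_classical all_reals all_analysis.
From mathcomp Require Import measurable_realfun ess_sup_inf.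
From mathcomp Require Import lra ring.

Set Implicit Arguments.
Unset Strict Implicit.
Unset Printing Implicit Defensive.
Import Order.TTheory GRing.Theory Num.Theory.
Import numFieldNormedType.Exports.

Local Open Scope classical_set_scope.
Local Open Scope ring_scope.

(* With sigma(t) = (max(0, t - (tn - H)) / H)^(k+1), the curve is the
   reparametrized geodesic t |-> gamma (sigma t).  The geodesic has zero
   acceleration, so the chain rule makes the j-th covariant derivative of the
   velocity equal to sigma^(j+1)(t) V_{sigma(t)}, and the k-th one has norm
   ((k+1)! / H^(k+1)) W2(mu0, nu) <= eps.

   Zero acceleration is derived from the continuity of t |-> V_t along the flow:
   testing a coupling of gamma_t and gamma_{t+h} against a second-order Taylor
   expansion and letting h -> 0 bounds the norm of the tangent field V_t by the
   metric speed; hence the flow moves masses at most as far as the geodesic does,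
   and strict convexity of the L2 norm forces straight trajectories
   X_{0,s} = id + s D with V_s (X_{0,s} x) = D x, D = X_{0,1} - id.  In particular
   X_{0,1} is an optimal map, which puts the geodesic in F. *)

(** * Euclidean structure and Borel measurability in R^d *)

(** Origin of the constant: by Taylor's formula from tn - H, a function that vanishes up to tn - H
    and equals 1 at tn is at most H^(k+1) / (k+1)! times the supremum of its (k+1)-st derivative,
    and the truncated monomial attains equality. Its lower derivatives vanish at tn - H, so only the
    last one jumps there, at a single instant that the essential supremum ignores. For k >= 1 this
    sigma is C^1, as the chain rule requires; for k = 0 it has a corner, but the class then asks for
    no covariant derivative. Two obstacles shape the proof. Identities along the flow hold up to
    negligible sets that depend on the time, so statements about all times at one starting point go
    through Tonelli or through the integrated ODE. Moreover sigma collapses the whole half-line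
    before tn - H to time 0, so a property known at almost every time of the geodesic cannot simply
    be composed with sigma; it is first upgraded to every time of [0, 1], endpoints included. *)

Section dot_theory.
Variables (R : realType) (d : nat).
Implicit Types x y z : 'rV[R]_d.

Lemma dotC x y : dot x y = dot y x.
Proof. by apply: eq_bigr => i _; rewrite mulrC. Qed.

Lemma dotDl x y z : dot (x + y) z = dot x z + dot y z.
Proof. by rewrite -big_split; apply: eq_bigr => i _; rewrite mxE mulrDl. Qed.

Lemma dotZl a x y : dot (a *: x) y = a * dot x y.
Proof. by rewrite mulr_sumr; apply: eq_bigr => i _; rewrite mxE mulrA. Qed.

Lemma dotDr x y z : dot z (x + y) = dot z x + dot z y.
Proof. by rewrite dotC dotDl !(dotC z). Qed.

Lemma dotZr a x y : dot y (a *: x) = a * dot y x.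
Proof. by rewrite dotC dotZl dotC. Qed.

Lemma dotNl x y : dot (- x) y = - dot x y.
Proof. by rewrite -scaleN1r dotZl mulN1r. Qed.

Lemma dotNr x y : dot y (- x) = - dot y x.
Proof. by rewrite dotC dotNl dotC. Qed.

Lemma dot0l x : dot 0 x = 0.
Proof. by rewrite -(scale0r 0) dotZl mul0r. Qed.

Lemma dot_ge0 x : 0 <= dot x x.
Proof. by apply: sumr_ge0 => i _; rewrite -expr2 sqr_ge0. Qed.

Lemma dot_eq0 x : dot x x <= 0 -> x = 0.
Proof.
move=> x0; have /eqP : dot x x = 0 by apply/eqP; rewrite eq_le x0 dot_ge0.
rewrite psumr_eq0; last by move=> i _; rewrite -expr2 sqr_ge0.
move=> /allP xi; apply/rowP => i; rewrite mxE.
by have /eqP := xi i (mem_index_enum _); move/eqP; rewrite -expr2 sqrf_eq0 => /eqP.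
Qed.

Lemma enorm_sqr x : enorm x ^+ 2 = dot x x.
Proof. by rewrite sqr_sqrtr// dot_ge0. Qed.

Lemma enorm_le (c : R) x : 0 <= c -> (enorm x <= c) = (dot x x <= c ^+ 2).
Proof.
by move=> c0; rewrite -enorm_sqr ler_pXn2r// ?nnegrE ?sqrtr_ge0.
Qed.

Definition dotE := (dotDl, dotDr, dotNl, dotNr, dotZl, dotZr).

Lemma dot_amgm (a : R) x y : 0 < a ->
  2 * dot x y <= a * dot x x + a^-1 * dot y y.
Proof.
move=> a0; have := dot_ge0 (a *: x - y); rewrite !dotE (dotC y x) => h.
rewrite -(ler_pM2l a0) mulrDr mulVKf ?gt_eqF//; lra.
Qed.

Lemma dotD_le x y : dot (x + y) (x + y) <= 2 * dot x x + 2 * dot y y.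
Proof. by have := dot_ge0 (x - y); rewrite !dotE (dotC y x); lra. Qed.

End dot_theory.

Section borel.
Variables (R : realType) (d : nat).
Notation E := 'rV[R]_d.

Lemma open_measurable_rV (A : set E) : open A -> measurable A.
Proof. by move=> oA; apply: sub_sigma_algebra. Qed.

Lemma continuous_measurable_rV (f : E -> R) :
  continuous f -> measurable_fun setT f.
Proof.
move=> cf; apply: (measurability _ (RGenOInfty.measurableE R)).
move=> _ [_ [a ->] <-].
rewrite setTI; apply: open_measurable_rV; move/continuousP : cf; apply.
exact: rray_open.
Qed.

Lemma coord_cts (i : 'I_d) : continuous (fun x : E => x 0 i).
Proof. exact: coord_continuous. Qed.

Lemma measurable_coord (i : 'I_d) : measurable_fun setT (fun x : E => x 0 i).
Proof. by apply: continuous_measurable_rV; exact: coord_cts. Qed.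

Let box (q : 'rV[rat]_d) (n : nat) : set E :=
  [set y | forall i, `|y 0 i - ratr (q 0 i)| < n.+1%:R^-1].

(** Rational boxes form a countable base, which reduces Borel measurability to coordinates. Boxes
    not contained in A are replaced by the empty set, so that the union is indexed by a countable
    type. *)
Lemma open_boxes (A : set E) : open A ->
  A = \bigcup_qn (if `[< box qn.1 qn.2 `<=` A >] then box qn.1 qn.2 else set0).
Proof.
move=> oA; apply/seteqP; split => [x Ax|x [qn _]]; last first.
  by case: ifPn => // /asboolP; exact.
have : nbhs x A by apply: open_nbhs_nbhs.
move=> /nbhs_ballP[e /= e0 xeA].
have [n] : exists n : nat, n.+1%:R^-1 < e / 2.
  have [n _ h] := near_infty_natSinv_lt (PosNum (divr_gt0 e0 (ltr0n _ 2))).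
  by exists n; exact: (h n (leqnn n)).
move=> ne.
pose r : R := n.+1%:R^-1; rewrite -/r in ne.
have r0 : 0 < r by rewrite invr_gt0.
have /choice[q qx] : forall i, exists q : rat, `|x 0 i - ratr q| < r.
  move=> i; have [|q] := @rat_in_itvoo _ (x 0 i - r) (x 0 i + r).
    by rewrite ltrD2l gtrN.
  rewrite in_itv/= => /andP[q1 q2]; exists q; rewrite ltr_norml; apply/andP.
  by move: (ratr q : R) (x 0 i) q1 q2 => u v q1 q2; split; lra.
have bA : box (\row_i q i) n `<=` A.
  move=> y yb; apply: xeA; split=> // i j; rewrite (ord1 i) /ball/=.
  have := yb j; have := qx j; rewrite mxE -/r => h1 h2.
  rewrite (_ : _ - _ = (x 0 j - ratr (q j)) - (y 0 j - ratr (q j))); last by ring.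
  by apply: le_lt_trans (ler_normB _ _) _; lra.
exists (\row_i q i, n) => //=; case: asboolP => // _ i.
by rewrite mxE; exact: qx.
Qed.

Lemma measurable_fun_rV d' (T : measurableType d') (D : set T) (f : T -> E) :
  (forall i, measurable_fun D (fun x => f x 0 i)) -> measurable_fun D f.
Proof.
move=> mf mD; apply: (measurability (open : set (set E))) => //.
move=> _ [A oA <-].
rewrite (open_boxes oA) preimage_bigcup setI_bigcupr.
apply: countable_bigcupT_measurable => [|[q n] /=]; first exact: countableP.
case: ifPn => _; last by rewrite preimage_set0 setI0.
(* The outer intersection with [D] matters for d = 0, where the indexed one is the whole space. *)
rewrite (_ : _ `&` _ = \bigcap_(i in [set: 'I_d])
    (D `&` (fun x => f x 0 i) @^-1` ball (ratr (q 0 i) : R) n.+1%:R^-1) `&` D).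
  apply: measurableI => //; apply: fin_bigcap_measurable => // i _.
  by apply: mf => //; exact: measurable_ball.
apply/seteqP; split => [x [Dx xb]|x [xb Dx]].
  by split=> // i _; split=> //; rewrite /= /ball/= distrC.
by split=> // i; have [_] := xb i I; rewrite /= /ball/= distrC.
Qed.

Section ops.
Context d' (T : measurableType d') (D : set T).
Implicit Types u v : T -> E.

Lemma measurable_rV_coord u i :
  measurable_fun D u -> measurable_fun D (fun x => u x 0 i).
Proof. exact: (measurableT_comp (measurable_coord i)). Qed.

Lemma measurable_rVD u v : measurable_fun D u -> measurable_fun D v ->
  measurable_fun D (fun x => u x + v x).
Proof.
move=> mu mv; apply: measurable_fun_rV => i.
apply: (eq_measurable_fun (fun x => u x 0 i + v x 0 i)) => [x _|]; first by rewrite mxE.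
by apply: measurable_funD; exact: measurable_rV_coord.
Qed.

Lemma measurable_rVZ (f : T -> R) u : measurable_fun D f -> measurable_fun D u ->
  measurable_fun D (fun x => f x *: u x).
Proof.
move=> mf mu; apply: measurable_fun_rV => i.
apply: (eq_measurable_fun (fun x => f x * u x 0 i)) => [x _|]; first by rewrite mxE.
by apply: measurable_funM => //; exact: measurable_rV_coord.
Qed.

Lemma measurable_rVB u v : measurable_fun D u -> measurable_fun D v ->
  measurable_fun D (fun x => u x - v x).
Proof.
move=> mu mv; apply: measurable_rVD => //.
rewrite (_ : (fun x => - v x) = (fun x => (cst (-1) : T -> R) x *: v x)).
  by apply: measurable_rVZ.
by apply/funext => x; rewrite scaleN1r.
Qed.

Lemma measurable_dot u v : measurable_fun D u -> measurable_fun D v ->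
  measurable_fun D (fun x => dot (u x) (v x)).
Proof.
move=> mu mv; apply: measurable_sum => i.
by apply: measurable_funM; exact: measurable_rV_coord.
Qed.

Lemma measurable_sq u : measurable_fun D u ->
  measurable_fun D (fun x => (dot (u x) (u x))%:E).
Proof. by move=> mu; apply/measurable_EFinP; exact: measurable_dot. Qed.

Lemma measurable_eq_rV u v : measurable D ->
  measurable_fun D u -> measurable_fun D v ->
  measurable (D `&` [set x | u x = v x]).
Proof.
move=> mD mu mv.
rewrite (_ : _ `&` _ = D `&` (fun x => dot (u x - v x) (u x - v x)) @^-1` [set 0]).
  by apply: measurable_dot => //; exact: measurable_rVB.
apply/seteqP; split => x [Dx] /= uv; split => //.
  by rewrite uv subrr dot0l.
by apply/eqP; rewrite -subr_eq0; apply/eqP/dot_eq0; rewrite uv.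
Qed.

End ops.

Section norm.
Context d' (T : measurableType d') (mu : {measure set T -> \bar R}).
Implicit Types u : T -> E.

Lemma sq_ge0 u : (0 <= \int[mu]_x (dot (u x) (u x))%:E)%E.
Proof. by apply: integral_ge0 => x _; rewrite lee_fin dot_ge0. Qed.

Lemma Lnorm2E u :
  ('N[mu]_(2%:E)[EFin \o (fun x => enorm (u x))] =
   (\int[mu]_x (dot (u x) (u x))%:E) `^ 2^-1)%E.
Proof.
rewrite unlock; congr (_ `^ _)%E; apply: eq_integral => x _.
by rewrite /= powR_mulrn// ger0_norm ?sqrtr_ge0// enorm_sqr.
Qed.

Lemma Lnorm2_le u (c : R) : 0 <= c ->
  ('N[mu]_(2%:E)[EFin \o (fun x => enorm (u x))] <= c%:E)%E =
  (\int[mu]_x (dot (u x) (u x))%:E <= (c ^+ 2)%:E)%E.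
Proof.
move=> c0; rewrite Lnorm2E; have := sq_ge0 u.
case: (\int[mu]_x (dot (u x) (u x))%:E)%E => [r| |]//= r0; last first.
  by rewrite invr_eq0 pnatr_eq0/= !leye_eq.
by rewrite !lee_fin powR12_sqrt// -[in LHS](ger0_norm c0) -sqrtr_sqr ler_sqrt// sqr_ge0.
Qed.

End norm.

End borel.

(** * Taylor estimates for test functions *)

Section test_functions.
Variables (R : realType) (d : nat).
Notation E := 'rV[R]_d.
Implicit Types f phi : E -> R.

(** The one-variable mean value theorem on the line through z. The increment [D] may have either
    sign, since it will be a difference of coordinates. *)
Lemma directional_mvt f (z e : E) (D : R) : (forall x, derivable f x e) ->
  exists t : R, `|t| <= `|D| /\ f (z + D *: e) - f z = 'D_e f (z + t *: e) * D.
Proof.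
move=> df; pose g s := f (z + s *: e).
have dg (s : R) : is_derive s 1 (g : R -> R) ('D_e f (z + s *: e)).
  have eqg : (fun h : R => h^-1 *: (g (h *: 1 + s) - g s)) =
             (fun h : R => h^-1 *: (f (h *: e + (z + s *: e)) - f (z + s *: e))).
    apply/funext => h; rewrite /g.
    by rewrite [h *: 1]mulr1 scalerDl addrCA.
  split; first by rewrite /derivable eqg; exact: df.
  by rewrite /derive eqg.
have cg a b : {within `[a, b], continuous (g : R -> R)}.
  apply: continuous_subspaceT => s; apply: differentiable_continuous.
  by apply/derivable1_diffP; exact: (@ex_derive _ _ _ _ _ _ _ (dg s)).
have [D0|D0] := leP 0 D.
  have [t /[!in_itv]/= /andP[t0 tD]] :=
    MVT_segment D0 (fun s _ => dg s) (cg 0 D).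
  rewrite {1 2}/g scale0r addr0 subr0 => h; exists t; split => //.
  by rewrite !ger0_norm.
have [t /[!in_itv]/= /andP[t0 tD]] :=
  MVT_segment (ltW D0) (fun s _ => dg s) (cg D 0).
rewrite {1 2}/g scale0r addr0 sub0r => h; exists t; split => //.
  by rewrite !ler0_norm ?lerN2// ltW.
by rewrite -[LHS]opprB h; lra.
Qed.

(** Smoothness is given through partial derivatives, so one goes from x to y along the axes,
    changing one coordinate at a time, with a mean value point on each edge. *)
Lemma telescoping_mvt f (x y : E) : (forall i z, derivable f z (delta_mx 0 i)) ->
  exists xi : 'I_d -> E, (forall i j, `|xi i 0 j - x 0 j| <= `|y 0 j - x 0 j|) /\
    f y - f x = \sum_i 'D_(delta_mx 0 i) f (xi i) * (y 0 i - x 0 i).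
Proof.
move=> df; pose z (k : nat) : E := \row_j (if (j < k)%N then y 0 j else x 0 j).
have zS (i : 'I_d) : z i.+1 = z i + (y 0 i - x 0 i) *: delta_mx 0 i.
  apply/rowP => j; rewrite !mxE eqxx/= ltnS leq_eqVlt.
  have [->|ji] := eqVneq j i; first by rewrite eqxx ltnn/= mulr1 addrC subrK.
  by rewrite (negbTE (_ : val j != val i)) ?orFb ?mulr0 ?addr0 //.
have /choice[t ht] (i : 'I_d) := directional_mvt (z i) (y 0 i - x 0 i) (df i).
exists (fun i : 'I_d => z i + t i *: delta_mx 0 i); split.
  move=> i j; rewrite !mxE eqxx/=; have [->|ji] := eqVneq j i.
    by rewrite ltnn mulr1 [_ + t i]addrC addrK; exact: (ht i).1.
  by rewrite mulr0 addr0; case: ifPn => // _; rewrite subrr normr0.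
have -> : f y - f x = \sum_(0 <= k < d) (f (z k.+1) - f (z k)).
  rewrite telescope_sumr//; congr (f _ - f _); apply/rowP => j; rewrite mxE//.
  by rewrite ltn_ord.
by rewrite big_mkord; apply: eq_bigr => i _; rewrite zS; exact: (ht i).2.
Qed.

Lemma pderiv_support phi s x : x \notin fsupport phi -> pderiv s phi x = 0.
Proof.
elim: s x => [|i s IH] x xs /=.
  apply/eqP; apply: contraNT xs => phix; rewrite inE.
  exact: subset_closure.
have : \forall y \near x, pderiv s phi y = cst 0 y.
  have : open (~` fsupport phi) by apply: closed_openC; exact: closed_closure.
  move=> oS; rewrite notin_setE in xs; have := open_nbhs_nbhs (conj oS xs).
  by apply: filterS => y ys; apply: IH; rewrite notin_setE.
move=> /near_eq_derive ->; first by rewrite derive_cst.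
Qed.

Lemma test_function_bounded phi s : test_function phi ->
  exists M : R, 0 <= M /\ forall x, `|pderiv s phi x| <= M.
Proof.
move=> [sm cphi].
have cp : continuous (pderiv s phi) := (sm (size s) s (leqnn _)).1.
have : compact (pderiv s phi @` fsupport phi).
  by apply: continuous_compact => //; exact: continuous_subspaceT.
move=> /compact_bounded[N [Nr hN]].
exists (`|N| + 1); split => // x.
have [xs|xs] := boolP (x \in fsupport phi); last first.
  by rewrite pderiv_support// normr0 addr_ge0.
apply: (hN (`|N| + 1)); first by rewrite (le_lt_trans (ler_norm _))// ltrDl.
by exists x => //; rewrite inE in xs.
Qed.

Lemma test_function_derivable phi s i x : test_function phi ->
  derivable (pderiv s phi) x (delta_mx 0 i).
Proof. by move=> [sm _]; apply: (sm (size s).+1 s _).2. Qed.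

(** At the intermediate points of [telescoping_mvt], each partial derivative differs from its value
    at x by at most C times the l^1 norm of y - x. AM-GM on the products of coordinates then gives
    the constant C d. *)
Lemma test_function_taylor phi : test_function phi ->
  exists M : R, 0 <= M /\ forall x y,
    `|phi y - phi x - dot (grad phi x) (y - x)| <= M * dot (y - x) (y - x).
Proof.
move=> tphi.
have /choice[B hB] (ij : 'I_d * 'I_d) :=
  test_function_bounded [:: ij.1; ij.2] tphi.
(* A common bound for all second partial derivatives. *)
pose C := \sum_ij B ij.
have C0 : 0 <= C by apply: sumr_ge0 => ij _; exact: (hB ij).1.
have BC ij : B ij <= C.
  by rewrite /C (bigD1 ij)//= lerDl sumr_ge0// => kl _; exact: (hB kl).1.
have lip i (x z D : E) : (forall j, `|z 0 j - x 0 j| <= `|D 0 j|) ->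
    `|pderiv [:: i] phi z - pderiv [:: i] phi x| <= \sum_j C * `|D 0 j|.
  move=> zD; have [|xi [_ ->]] := @telescoping_mvt (pderiv [:: i] phi) x z.
    by move=> j w; exact: test_function_derivable.
  apply: le_trans (ler_norm_sum _ _ _) _; apply: ler_sum => j _.
  rewrite normrM; apply: ler_pM => //.
  exact: le_trans ((hB (j, i)).2 (xi j)) (BC _).
exists (C * d%:R); split; first by rewrite mulr_ge0.
move=> x y; have [|xi [hxi ->]] := @telescoping_mvt phi x y.
  by move=> j w; exact: (@test_function_derivable phi [::]).
rewrite /dot -sumrB.
under eq_bigr do rewrite !mxE -mulrBl.
apply: le_trans (ler_norm_sum _ _ _) _.
apply: (@le_trans _ _ (\sum_i \sum_j C / 2 * ((y - x) 0 i ^+ 2 + (y - x) 0 j ^+ 2))).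
  apply: ler_sum => i _; rewrite normrM.
  apply: le_trans (ler_wpM2r (normr_ge0 _) (lip i x (xi i) (y - x) _)) _.
    by move=> j; rewrite !mxE; exact: hxi.
  rewrite mulr_suml; apply: ler_sum => j _; rewrite -!mulrA ler_wpM2l// !mxE.
  rewrite -(real_normK (num_real (y 0 i - _))) -(real_normK (num_real (y 0 j - _))).
  move: (`|y 0 i - x 0 i|) (`|y 0 j - x 0 j|) => a b.
  by have := sqr_ge0 (a - b); rewrite sqrrB; lra.
pose S := \sum_i (y - x) 0 i ^+ 2.
have -> : \sum_i (y - x) 0 i * (y - x) 0 i = S.
  by apply: eq_bigr => i _; rewrite expr2.
have -> : \sum_i \sum_j C / 2 * ((y - x) 0 i ^+ 2 + (y - x) 0 j ^+ 2) =
          \sum_i C / 2 * ((y - x) 0 i ^+ 2 *+ d + S).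
  by apply: eq_bigr => i _; rewrite -mulr_sumr big_split/= sumr_const card_ord.
rewrite -mulr_sumr big_split/= sumr_const card_ord sumrMnl -/S -(mulr_natr S).
lra.
Qed.


Lemma measurable_pderiv phi s : test_function phi ->
  measurable_fun setT (pderiv s phi).
Proof.
by move=> tphi; apply: continuous_measurable_rV; exact: (tphi.1 (size s) s _).1.
Qed.

Lemma measurable_grad phi : test_function phi -> measurable_fun setT (grad phi).
Proof.
move=> tphi; apply: measurable_fun_rV => i.
apply: (eq_measurable_fun (pderiv [:: i] phi)) => [x _|]; first by rewrite mxE.
exact: measurable_pderiv.
Qed.

Lemma grad_bounded phi : test_function phi ->
  exists M : R, 0 <= M /\ forall x, dot (grad phi x) (grad phi x) <= M.
Proof.
move=> tphi; have /choice[B hB] i := test_function_bounded [:: i] tphi.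
exists (\sum_i B i ^+ 2); split; first by apply: sumr_ge0 => i _; exact: sqr_ge0.
move=> x; apply: ler_sum => i _; rewrite !mxE -expr2.
by rewrite -(real_normK (num_real _)) ler_pXn2r ?nnegrE ?(hB i).1 ?(hB i).2.
Qed.

Lemma pderivZ phi c s : test_function phi ->
  pderiv s (fun x => c * phi x) = (fun x => c * pderiv s phi x).
Proof.
move=> tphi; elim: s => [//|i s IH]; apply/funext => x /=; rewrite IH.
rewrite -[LHS]/('D_(delta_mx 0 i) (c \*: pderiv s phi) x) deriveZ//.
exact: test_function_derivable.
Qed.

Lemma test_functionZ phi c : test_function phi -> test_function (fun x => c * phi x).
Proof.
move=> tphi; split.
  move=> m s sm; rewrite pderivZ//; split.
    move=> x; have cx := (tphi.1 m s sm).1 x.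
    exact: (cvgM (cvg_cst c) cx).
  move=> _ i x; apply: (@derivableZ _ _ _ (pderiv s phi)).
  exact: test_function_derivable.
apply: (subclosed_compact _ tphi.2); first exact: closed_closure.
by apply: closure_subset => x /=; apply: contra_neq => ->; rewrite mulr0.
Qed.

Lemma gradZ phi c : test_function phi ->
  grad (fun x => c * phi x) = (fun x => c *: grad phi x).
Proof.
move=> tphi; apply/funext => x; apply/rowP => i; rewrite !mxE.
exact: (congr1 (fun f => f x) (pderivZ c [:: i] tphi)).
Qed.

(** Adding the Taylor estimates from a to b and from b to a cancels the values of phi and leaves the
    difference of slopes times s - t, bounded quadratically in s - t. *)
Lemma test_function_grad_lipschitz phi : test_function phi ->
  exists M : R, 0 <= M /\ forall x z (s t : R),
    `|dot z (grad phi (x + s *: z)) - dot z (grad phi (x + t *: z))| <=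
    M * `|s - t| * dot z z.
Proof.
move=> /test_function_taylor[M [M0 hM]]; exists (2 * M); split; first lra.
move=> x z s t; have [->|st] := eqVneq s t.
  by rewrite !subrr normr0 mulr0 mul0r.
set a := x + s *: z; set b := x + t *: z.
have := hM a b; have := hM b a.
have -> : b - a = (t - s) *: z by rewrite /a /b opprD addrACA subrr add0r scalerBl.
have -> : a - b = (s - t) *: z by rewrite /a /b opprD addrACA subrr add0r scalerBl.
rewrite !dotE -/a -/b !(dotC (grad phi _)).
set A := dot z (grad phi a); set B := dot z (grad phi b) => h1 h2.
have st0 : 0 < `|s - t| by rewrite normr_gt0 subr_eq0.
have h : `|(s - t) * (A - B)| <= 2 * M * ((s - t) * ((s - t) * dot z z)).
  rewrite (_ : _ * (A - B) = (phi b - phi a - (t - s) * A) +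
     (phi a - phi b - (s - t) * B)); last by ring.
  apply: le_trans (ler_normD _ _) _.
  by apply: le_trans (lerD h2 h1) _; rewrite -[X in X <= _]addr0; lra.
rewrite -(ler_pM2l st0) -normrM; apply: le_trans h _.
rewrite [X in _ <= X](_ : _ = 2 * M * (`|s - t| ^+ 2 * dot z z)); last by ring.
by rewrite real_normK ?num_real// [X in X <= _](_ : _ = 2 * M * ((s - t) ^+ 2 * dot z z))//; ring.
Qed.

End test_functions.

(** * Image measures and square-integrable fields *)

Section image_measure.
Context d1 d2 (T1 : measurableType d1) (T2 : measurableType d2) (R : realType).
Variables (mu : {measure set T1 -> \bar R}) (nu : {measure set T2 -> \bar R}).
Variable T : T1 -> T2.
Hypothesis mT : measurable_fun setT T.
Hypothesis nuE : forall A, measurable A -> nu A = mu (T @^-1` A).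

Lemma ae_preimage (P : T2 -> Prop) :
  (\forall y \ae nu, P y) -> \forall x \ae mu, P (T x).
Proof.
move=> [N [mN N0 PN]]; exists (T @^-1` N); split.
- by rewrite -[X in measurable X]setTI; exact: mT.
- by rewrite -nuE.
- by move=> x /= Px; exact: PN.
Qed.

(** The converse of [ae_preimage]. Here P must be measurable, because a null set upstairs need not
    be the preimage of a measurable set. *)
Lemma ae_image (P : set T2) : measurable P ->
  (\forall x \ae mu, P (T x)) -> \forall y \ae nu, P y.
Proof.
move=> mP [N [mN N0 PN]]; exists (~` P); split=> //.
  exact: measurableC.
rewrite nuE; last exact: measurableC.
have mTP : measurable (T @^-1` (~` P)).
  by rewrite -[X in measurable X]setTI; apply: mT => //; exact: measurableC.
by apply/eqP; rewrite eq_le measure_ge0 andbT -N0 le_measure// inE.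
Qed.

Lemma ge0_integral_image (f : T2 -> \bar R) : measurable_fun setT f ->
  (forall y, (0 <= f y)%E) -> (\int[nu]_y f y = \int[mu]_x f (T x))%E.
Proof.
move=> mf f0; rewrite (eq_measure_integral (pushforward mu T)); last first.
  by move=> A mA _; rewrite nuE.
by rewrite ge0_integral_pushforward// preimage_setT.
Qed.

Lemma integral_image (f : T2 -> R) : measurable_fun setT f ->
  mu.-integrable setT (EFin \o (f \o T)) ->
  \int[nu]_y f y = \int[mu]_x f (T x).
Proof.
move=> mf fT; rewrite /Rintegral (eq_measure_integral (pushforward mu T)); last first.
  by move=> A mA _; rewrite nuE.
by rewrite integral_pushforward ?preimage_setT//; exact/measurable_EFinP.
Qed.

End image_measure.

Section integral_comb.
Context d' (T : measurableType d') (R : realType) (mu : {measure set T -> \bar R}).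

Lemma integrable_comb (a b : R) (f g : T -> R) :
  mu.-integrable setT (EFin \o f) -> mu.-integrable setT (EFin \o g) ->
  mu.-integrable setT (EFin \o (fun x => a * f x + b * g x)).
Proof.
move=> fint gint.
exact: (integrableD measurableT (integrableZl measurableT a fint)
                    (integrableZl measurableT b gint)).
Qed.

Lemma Rintegral_comb (a b : R) (f g : T -> R) :
  mu.-integrable setT (EFin \o f) -> mu.-integrable setT (EFin \o g) ->
  \int[mu]_x (a * f x + b * g x) = a * \int[mu]_x f x + b * \int[mu]_x g x.
Proof.
move=> fint gint; rewrite RintegralD ?RintegralZl//.
- exact: (integrableZl measurableT a fint).
- exact: (integrableZl measurableT b gint).
Qed.

End integral_comb.

Section square_integrable.
Context d' (T : measurableType d') (R : realType) (d : nat).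
Variable mu : probability T R.
Implicit Types u v w : T -> 'rV[R]_d.

Definition sq_integrable u :=
  measurable_fun setT u /\ mu.-integrable setT (fun x => (dot (u x) (u x))%:E).

Definition sqnorm u : R := \int[mu]_x dot (u x) (u x).

Lemma sqnormE u : sq_integrable u ->
  (\int[mu]_x (dot (u x) (u x))%:E = (sqnorm u)%:E)%E.
Proof. by move=> [mu_ iu]; rewrite fineK//; exact: integrable_fin_num. Qed.

Lemma sqnorm_ge0 u : 0 <= sqnorm u.
Proof. by apply: Rintegral_ge0 => x _; exact: dot_ge0. Qed.

Lemma sq_integrable_lty u : measurable_fun setT u ->
  (\int[mu]_x (dot (u x) (u x))%:E < +oo)%E -> sq_integrable u.
Proof.
move=> mu_ h; split => //; apply/integrableP; split; first exact: measurable_sq.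
by under eq_integral do rewrite gee0_abs ?lee_fin ?dot_ge0//.
Qed.

Lemma sq_integrable_le u (K : R) : measurable_fun setT u ->
  (\int[mu]_x (dot (u x) (u x))%:E <= K%:E)%E -> sq_integrable u /\ sqnorm u <= K.
Proof.
move=> mu_ h; have su : sq_integrable u.
  by apply: sq_integrable_lty => //; exact: le_lt_trans h (ltry _).
by split=> //; rewrite -lee_fin -sqnormE.
Qed.

Lemma sq_integrable_dot u v : sq_integrable u -> sq_integrable v ->
  mu.-integrable setT (fun x => (dot (u x) (v x))%:E).
Proof.
move=> [mu_ iu] [mv iv].
apply: (le_integrable measurableT _ _ (integrableD measurableT iu iv)) => //.
  by apply/measurable_EFinP; exact: measurable_dot.
move=> x _ /=; rewrite lee_fin [X in _ <= X]ger0_norm ?addr_ge0 ?dot_ge0//.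
have := dot_ge0 (u x + v x); have := dot_ge0 (u x - v x).
rewrite !dotE (dotC (v x)); have := dot_ge0 (u x); have := dot_ge0 (v x).
by move=> ? ? ? ?; rewrite ler_norml; apply/andP; split; lra.
Qed.

Lemma sq_integrableZ (c : R) u : sq_integrable u ->
  sq_integrable (fun x => c *: u x).
Proof.
move=> [mu_ iu]; split; first exact: measurable_rVZ.
rewrite (_ : (fun x => _) = (fun x => (c * c)%:E * (dot (u x) (u x))%:E))%E.
  exact: integrableZl.
by apply/funext => x; rewrite !dotE mulrA.
Qed.

Lemma sq_integrableD u v : sq_integrable u -> sq_integrable v ->
  sq_integrable (fun x => u x + v x).
Proof.
move=> su sv; split; first by apply: measurable_rVD; [exact: su.1|exact: sv.1].
have i1 := integrableD measurableT su.2 (sq_integrable_dot su sv).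
have i2 := integrableD measurableT (sq_integrable_dot sv su) sv.2.
apply: eq_integrable (integrableD measurableT i1 i2) => // x _ /=.
by rewrite !dotE -!EFinD addrA.
Qed.

Lemma sq_integrableB u v : sq_integrable u -> sq_integrable v ->
  sq_integrable (fun x => u x - v x).
Proof.
move=> su sv; rewrite (_ : (fun x => _) = (fun x => u x + (-1) *: v x)).
  by apply: sq_integrableD => //; exact: sq_integrableZ.
by apply/funext => x; rewrite scaleN1r.
Qed.

Lemma sq_integrable_bounded u (M : R) : measurable_fun setT u ->
  (forall x, dot (u x) (u x) <= M) -> sq_integrable u.
Proof.
move=> mu_ uM; apply: sq_integrable_lty => //.
apply: (@le_lt_trans _ _ (\int[mu]_x (cst M%:E x))%E); last first.
  by rewrite integral_cst// [X in (_ * X)%E](_ : _ = 1%E) ?mule1 ?ltry//; exact: probability_setT.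
apply: ge0_le_integral => //.
- by move=> x _; rewrite lee_fin dot_ge0.
- exact: measurable_sq.
- by move=> x _; rewrite lee_fin (le_trans _ (uM x))// dot_ge0.
Qed.

Lemma sqnorm_eq0 u : sq_integrable u -> sqnorm u <= 0 -> \forall x \ae mu, u x = 0.
Proof.
move=> su u0.
have h : (\int[mu]_x (dot (u x) (u x))%:E = 0)%E.
  by rewrite sqnormE//; congr EFin; apply/eqP; rewrite eq_le u0 sqnorm_ge0.
have := (ae_eq_integral_abs mu measurableT (measurable_int _ su.2)).1.
rewrite (_ : (\int[mu]_(x in _) _)%E = 0%E).
  move=> /(_ erefl); apply: filterS => x /(_ I) [/eqP].
  by move=> /eqP h1; apply: dot_eq0; rewrite h1.
by rewrite -h; apply: eq_integral => x _; rewrite gee0_abs// lee_fin dot_ge0.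
Qed.

End square_integrable.

Section L2norm.
Context (R : realType) (d : nat).
Notation E := 'rV[R]_d.
Implicit Types (mu nu : probability E R) (u : E -> E).

Lemma in_L2_sq_integrable mu u : in_L2 mu u -> sq_integrable mu u.
Proof.
move=> [mu_ hu]; apply: sq_integrable_lty => //.
rewrite ltey; apply: contraTN hu => /eqP ioo.
by rewrite /L2norm Lnorm2E ioo /= invr_eq0 pnatr_eq0.
Qed.

Lemma L2norm_le mu u (c : R) : 0 <= c -> sq_integrable mu u ->
  (L2norm mu u <= c%:E)%E = (sqnorm mu u <= c ^+ 2).
Proof. by move=> c0 su; rewrite /L2norm Lnorm2_le// sqnormE. Qed.

Lemma L2norm_sqrt mu u : sq_integrable mu u ->
  L2norm mu u = (Num.sqrt (sqnorm mu u))%:E.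
Proof.
by move=> su; rewrite /L2norm Lnorm2E sqnormE// poweR_EFin powR12_sqrt ?sqnorm_ge0.
Qed.

Lemma sq_integrable_in_L2 mu u : sq_integrable mu u -> in_L2 mu u.
Proof. by move=> su; split; [exact: su.1|rewrite L2norm_sqrt// ltry]. Qed.

Lemma L2norm_ae_eq mu u v : measurable_fun setT u -> measurable_fun setT v ->
  (\forall x \ae mu, u x = v x) -> L2norm mu u = L2norm mu v.
Proof.
move=> mu_ mv uv; rewrite /L2norm !Lnorm2E; congr (_ `^ _)%E.
apply: ge0_ae_eq_integral => //; do ?exact: measurable_sq.
- by move=> x _; rewrite lee_fin dot_ge0.
- by move=> x _; rewrite lee_fin dot_ge0.
- by apply: filterS uv => x ->.
Qed.

Section pushes.
Variables (mu nu : probability E R) (T : E -> E).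
Hypothesis pT : pushes mu T nu.

Lemma pushes_comp u : measurable_fun setT u -> measurable_fun setT (u \o T).
Proof. by move=> mu_; apply: measurableT_comp => //; exact: pT.1. Qed.

Lemma pushes_integral_sq u : measurable_fun setT u ->
  (\int[nu]_y (dot (u y) (u y))%:E = \int[mu]_x (dot (u (T x)) (u (T x)))%:E)%E.
Proof.
move=> mu_.
rewrite (ge0_integral_image pT.1 pT.2 (measurable_sq mu_))// => y.
by rewrite lee_fin dot_ge0.
Qed.

Lemma pushes_sq_integrable u : sq_integrable nu u -> sq_integrable mu (u \o T).
Proof.
move=> su; have mu_ := su.1; apply: sq_integrable_lty; first exact: pushes_comp.
by rewrite -pushes_integral_sq// sqnormE// ltry.
Qed.

Lemma pushes_sqnorm u : measurable_fun setT u -> sqnorm nu u = sqnorm mu (u \o T).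
Proof. by move=> mu_; rewrite /sqnorm /Rintegral pushes_integral_sq. Qed.

End pushes.
End L2norm.

Lemma test_function_integrable (R : realType) (d : nat) (phi : 'rV[R]_d -> R) d'
    (T : measurableType d') (P : probability T R) (f : T -> 'rV[R]_d) :
  test_function phi -> measurable_fun setT f ->
  P.-integrable setT (EFin \o (phi \o f)).
Proof.
move=> tphi mf; have [Mphi [Mphi0 hphi]] := test_function_bounded [::] tphi.
have mphi : measurable_fun setT phi := measurable_pderiv [::] tphi.
apply: (@measurable_bounded_integrable _ _ _ P) => //.
- by rewrite [X in (X < _)%E](_ : _ = 1%E) ?ltry//; exact: probability_setT.
- exact: measurableT_comp.
- exists Mphi; split; first exact: num_real.
  by move=> b Mb x _; exact: le_trans (hphi _) (ltW Mb).
Qed.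

(** * Integrals over time *)

Section time_integrals.
Variable R : realType.
Notation leb := (@lebesgue_measure R).

(* Fields along curves are jointly measurable for times in [0, 1] only; clamping
   the time makes them so everywhere, as measurable_fun_pair and Tonelli need. *)
Definition clamp (r : R) : R := (`|r| - `|r - 1| + 1) / 2.

Lemma clamp_itv r : clamp r \in `[0, 1].
Proof.
rewrite in_itv/= /clamp; case: (ger0P r) => r0; case: (ger0P (r - 1)) => r1;
  apply/andP; split; lra.
Qed.

Lemma clampE r : r \in `[0, 1] -> clamp r = r.
Proof.
rewrite in_itv/= => /andP[r0 r1]; rewrite /clamp ger0_norm// ler0_norm ?subr_le0//.
lra.
Qed.

Lemma measurable_clamp : measurable_fun setT clamp.
Proof.
apply: measurable_funM => //; apply: measurable_funD => //.
apply: measurable_funB; first exact: normr_measurable.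
by apply: measurableT_comp; [exact: normr_measurable|exact: measurable_funB].
Qed.

Lemma lebesgue_itvcc (a b : R) : a <= b -> leb `[a, b] = (b - a)%:E.
Proof.
rewrite lebesgue_measure_itv/= lte_fin le_eqVlt => /predU1P[->|->//].
by rewrite ltxx subrr.
Qed.

Lemma lebesgue_itvco (a b : R) : a <= b -> leb `[a, b[ = (b - a)%:E.
Proof.
rewrite lebesgue_measure_itv/= lte_fin le_eqVlt => /predU1P[->|->//].
by rewrite ltxx subrr.
Qed.

Lemma integrable_cst_itv (a b c : R) : leb.-integrable `[a, b] (EFin \o cst c).
Proof.
have [ab|ba] := leP a b; last first.
  by rewrite set_itv_ge ?bnd_simp -?ltNge//; exact: integrable_set0.
apply/integrableP; split; first exact/measurable_EFinP.
rewrite (eq_integral (cst `|c|%:E))// integral_cst//.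
by rewrite [X in (_ * X)%E](lebesgue_itvcc ab) -EFinM ltry.
Qed.

Lemma Rintegral_cst_itv (a b c : R) : a <= b ->
  \int[leb]_(r in `[a, b]) c = c * (b - a).
Proof.
by move=> ab; rewrite Rintegral_cst// [X in fine X](lebesgue_itvcc ab).
Qed.

(** Cauchy-Schwarz against the constant 1. The right-hand side is an extended real because the
    square of an integrable f may have infinite integral. *)
Lemma sqr_integral_le (f : R -> R) (s t : R) : s <= t ->
  leb.-integrable `[s, t] (EFin \o f) ->
  (((\int[leb]_(r in `[s, t]) f r) ^+ 2)%:E <=
   (t - s)%:E * \int[leb]_(r in `[s, t]) ((f r) ^+ 2)%:E)%E.
Proof.
rewrite le_eqVlt => /predU1P[->|st] fint.
  by rewrite set_itv1 Rintegral_set1 expr0n/= subrr mul0e.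
have mf2 : measurable_fun `[s, t] (fun r => ((f r) ^+ 2)%:E).
  apply/measurable_EFinP; apply: measurable_funX.
  by apply/measurable_EFinP; exact: measurable_int fint.
have ts : 0 < t - s by rewrite subr_gt0.
have f20 : (0 <= \int[leb]_(r in `[s, t]) ((f r) ^+ 2)%:E)%E.
  by apply: integral_ge0 => r _; rewrite lee_fin sqr_ge0.
have [f2|] := boolP (\int[leb]_(r in `[s, t]) ((f r) ^+ 2)%:E < +oo)%E; last first.
  by rewrite -leNgt leye_eq => /eqP ->; rewrite gt0_muley ?lte_fin// leey.
have if2 : leb.-integrable `[s, t] (EFin \o (fun r => (f r) ^+ 2)).
  apply/integrableP; split => //.
  by under eq_integral do rewrite /= ger0_norm ?sqr_ge0//.
have -> : (\int[leb]_(r in `[s, t]) ((f r) ^+ 2)%:E =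
    (\int[leb]_(r in `[s, t]) ((f r) ^+ 2))%:E)%E.
  by rewrite fineK//; exact: integrable_fin_num if2.
rewrite -EFinM lee_fin; set I := \int[leb]_(r in _) f r.
(* The mean of f: integrating f^2 >= 2 l f - l^2 is sharpest for this l. *)
pose l := I / (t - s).
have il : leb.-integrable `[s, t] (EFin \o (fun r => 2 * l * f r)).
  exact: (integrableZl _ (2 * l) fint).
have : \int[leb]_(r in `[s, t]) (2 * l * f r - l ^+ 2) <=
       \int[leb]_(r in `[s, t]) (f r ^+ 2).
  apply: le_Rintegral => //.
    exact: (integrableB _ il (integrable_cst_itv s t (l ^+ 2))).
  by move=> r _; have := sqr_ge0 (f r - l); rewrite sqrrB; lra.
rewrite RintegralB//; last exact: (integrable_cst_itv s t (l ^+ 2)).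
rewrite RintegralZl// (Rintegral_cst_itv _ (ltW st)) -/I.
move=> /(ler_wpM2l (ltW ts)) h; apply: le_trans h.
by rewrite [leRHS](_ : _ = I ^+ 2)// /l; field; rewrite gt_eqF.
Qed.

(** Absolute continuity of the integral, applied to m extended by zero, so that h depends only on
    the length of the interval. *)
Lemma small_integral (m : R -> R) (e : R) : locally_integrable_on `[0, 1] m ->
  0 < e -> exists2 h : R, 0 < h & forall s t : R, 0 <= s -> s <= t -> t <= 1 ->
    t - s < h -> \int[leb]_(r in `[s, t]) `|m r| < e.
Proof.
move=> im e0.
have im1 : leb.-integrable `[0, 1] (EFin \o m) by apply: im; rewrite ?bound_itvE.
have imT : leb.-integrable setT (EFin \o (m \_ `[0, 1])).
  rewrite -restrict_EFin.
  have := (@integrable_mkcond _ _ _ leb `[0, 1]%classic (EFin \o m) (measurable_itv _)).1 im1.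
  exact.
have [h [h0 hm]] := integral_normr_continuous imT e0.
exists h => // s t s0 st t1 tsh.
have -> : \int[leb]_(r in `[s, t]) `|m r| =
          \int[leb]_(r in `[s, t]) `|(m \_ `[0, 1]) r|; last first.
  by apply: hm => //; rewrite [X in (X < _)%E](lebesgue_itvcc st) lte_fin.
apply: eq_Rintegral => r; rewrite inE/= in_itv/= => /andP[sr rt]; rewrite patchE mem_set//=.
by rewrite in_itv/=; apply/andP; split; lra.
Qed.

End time_integrals.

#[local] Instance lebesgue_ae_filter (R : realType) :
  Filter (nbhs (almost_everywhere (@lebesgue_measure R))).
Proof. exact: ae_filter_ringOfSetsType. Qed.

Lemma lebesgue_ae_neq (R : realType) (a : R) : \forall t \ae (@lebesgue_measure R), t != a.
Proof.
exists [set a]; split; [exact: measurable_set1|exact: lebesgue_measure_set1|].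
by move=> t /= /negP; rewrite negbK => /eqP.
Qed.

(** * Displacement along the flow *)

Section flow.
Variables (R : realType) (d : nat).
Notation E := 'rV[R]_d.
Notation leb := (@lebesgue_measure R).
Notation I01 := (Interval (BLeft (0:R)) (BRight (1:R))).
Variables (gamma : R -> probability E R) (V : R -> E -> E) (X : R -> R -> E -> E).
Hypothesis hV : measurable_fun ([set` I01] `*` [set: E])
  (fun p : R * E => V p.1 p.2).
Hypothesis hX : flow_maps I01 gamma V X.
Hypothesis hT : forall t, t \in I01 -> tangent (gamma t) (V t).

Lemma flow_pushes s t : s \in I01 -> t \in I01 -> pushes (gamma s) (X s t) (gamma t).
Proof. by case: hX => _ + _ _; exact. Qed.

Lemma flow_measurable s t : s \in I01 -> t \in I01 -> measurable_fun setT (X s t).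
Proof. by move=> sI tI; have [] := flow_pushes sI tI. Qed.

Lemma velocity_measurable t : t \in I01 -> measurable_fun setT (V t).
Proof. by move=> tI; have [[]] := hT tI. Qed.

Lemma velocity_sq_integrable t : t \in I01 -> sq_integrable (gamma t) (V t).
Proof. by move=> tI; apply: in_L2_sq_integrable; have [] := hT tI. Qed.

Lemma measurable_velocity_comp d' (T : measurableType d') (f : T -> R) (g : T -> E) :
  (forall x, f x \in I01) -> measurable_fun setT f -> measurable_fun setT g ->
  measurable_fun setT (fun x => V (f x) (g x)).
Proof.
move=> fI mf mg; pose fg x : R * E := (f x, g x).
have mfg : measurable_fun setT fg by exact: measurable_fun_pair.
have := measurable_comp _ _ hV mfg; apply.
  by apply: measurableX => //; exact: measurable_itv.
by move=> _ [x _ <-]; split => //=; exact: fI.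
Qed.

Lemma measurable_flow_comp d' (T : measurableType d') s (f : T -> R) (g : T -> E) :
  s \in I01 ->
  (forall x, f x \in I01) -> measurable_fun setT f -> measurable_fun setT g ->
  measurable_fun setT (fun x => X s (f x) (g x)).
Proof.
move=> sI fI mf mg; pose fg x : R * E := (f x, g x).
have mfg : measurable_fun setT fg by exact: measurable_fun_pair.
have [/(_ s sI) mX _ _ _] := hX.
have := measurable_comp _ _ mX mfg; apply.
  by apply: measurableX => //; exact: measurable_itv.
by move=> _ [x _ <-]; split => //=; exact: fI.
Qed.

Lemma in_I01_between r s t : s \in I01 -> t \in I01 -> s <= r -> r <= t -> r \in I01.
Proof.
by rewrite !in_itv/= => /andP[? _] /andP[_ ?] ? ?; apply/andP; split; lra.
Qed.

(** Integrate the ODE coordinate by coordinate and apply Cauchy-Schwarz in time. The reference field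
    c will be 0 to bound displacements and V_s to linearize the flow. *)
Lemma ode_sq_le s t (c : E -> E) : s \in I01 -> t \in I01 -> s <= t ->
  \forall x \ae gamma s,
  ((dot (X s t x - x - (t - s) *: c x) (X s t x - x - (t - s) *: c x))%:E <=
   (t - s)%:E * \int[leb]_(r in `[s, t])
     (dot (V r (X s r x) - c x) (V r (X s r x) - c x))%:E)%E.
Proof.
move=> sI tI st; have [_ _ _ /(_ s sI)] := hX; apply: filterS => x /(_ t tI st) ode.
pose f i r := V r (X s r x) 0 i - c x 0 i.
have fint i : leb.-integrable `[s, t] (EFin \o f i).
  exact: (integrableB _ (ode i).1 (integrable_cst_itv s t (c x 0 i))).
have fE i : (X s t x - x - (t - s) *: c x) 0 i = \int[leb]_(r in `[s, t]) f i r.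
  rewrite RintegralB//; first last.
  - exact: (integrable_cst_itv s t (c x 0 i)).
  - exact: (ode i).1.
  rewrite Rintegral_cst_itv// !mxE (ode i).2 [x 0 i + _]addrC addrK.
  by rewrite [_ * c x 0 i]mulrC.
rewrite /dot -sumEFin.
apply: (@le_trans _ _ (\sum_i (t - s)%:E * \int[leb]_(r in `[s, t]) (f i r ^+ 2)%:E)%E).
  by apply: lee_sum => i _; rewrite fE -expr2; exact: sqr_integral_le.
have mf i : measurable_fun `[s, t] (fun r => (f i r ^+ 2)%:E).
  apply/measurable_EFinP; apply: measurable_funX.
  by apply/measurable_EFinP; exact: measurable_int (fint i).
rewrite -ge0_sume_distrr; last first.
  by move=> i _; apply: integral_ge0 => r _; rewrite lee_fin sqr_ge0.
rewrite -ge0_integral_sum//; last by move=> i r _; rewrite lee_fin sqr_ge0.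
rewrite lee_wpmul2l ?lee_fin ?subr_ge0//.
rewrite le_eqVlt; apply/orP; left; apply/eqP; apply: eq_integral => r _.
by rewrite -sumEFin; apply: eq_bigr => i _; rewrite /f expr2 !mxE.
Qed.

(* Cauchy-Schwarz in time, then Tonelli. *)
Lemma displacement_le s t (c : E -> E) (K : R) :
  s \in I01 -> t \in I01 -> s <= t -> sq_integrable (gamma s) c ->
  (forall r, s <= r -> r < t ->
     sqnorm (gamma s) (fun x => V r (X s r x) - c x) <= K) ->
  sq_integrable (gamma s) (fun x => X s t x - x - (t - s) *: c x) /\
  sqnorm (gamma s) (fun x => X s t x - x - (t - s) *: c x) <= (t - s) ^+ 2 * K.
Proof.
move=> sI tI st sc hK; have mc := sc.1.
have mXst := flow_measurable sI tI.
have mD : measurable_fun setT (fun x => X s t x - x - (t - s) *: c x).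
  apply: measurable_rVB; first exact: measurable_rVB.
  exact: measurable_rVZ.
apply: sq_integrable_le => //.
pose u (z : E * R) := V (clamp z.2) (X s (clamp z.2) z.1) - c z.1.
have mu_ : measurable_fun setT u.
  have mcl : measurable_fun setT (fun z : E * R => clamp z.2).
    by apply: measurableT_comp measurable_snd; exact: measurable_clamp.
  apply: measurable_rVB; last by apply: measurableT_comp measurable_fst.
  apply: measurable_velocity_comp => //; first by move=> z; exact: clamp_itv.
  by apply: measurable_flow_comp => // z; exact: clamp_itv.
(* The interval is half-open because the bound [hK] is assumed for r < t only: the speed is
   controlled before the final time 1 first. *)
pose F (z : E * R) : \bar R := (\1_`[s, t[%classic z.2 * dot (u z) (u z))%:E.
have mF : measurable_fun setT F.
  apply/measurable_EFinP; apply: measurable_funM; last exact: measurable_dot.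
  by apply: measurableT_comp measurable_snd; exact: measurable_indic.
have F0 z : (0 <= F z)%E by rewrite lee_fin mulr_ge0 ?dot_ge0// indicE ler0n.
have mFx : measurable_fun setT (fun x => \int[leb]_r F (x, r))%E.
  exact: (@measurable_fun_fubini_tonelli_F _ _ _ _ _ leb F mF F0).
have mFr : measurable_fun setT (fun r => \int[gamma s]_x F (x, r))%E.
  exact: (@measurable_fun_fubini_tonelli_G _ _ _ _ _ (gamma s) F mF F0).
have FE x : (\int[leb]_r F (x, r) = \int[leb]_(r in `[s, t])
     (dot (V r (X s r x) - c x) (V r (X s r x) - c x))%:E)%E.
  have -> : (\int[leb]_(r in `[s, t])
     (dot (V r (X s r x) - c x) (V r (X s r x) - c x))%:E =
     \int[leb]_(r in `[s, t]) (dot (u (x, r)) (u (x, r)))%:E)%E.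
    apply: eq_integral => r; rewrite inE/= in_itv/= => /andP[sr rt].
    by rewrite /u/= clampE//; exact: (in_I01_between sI tI).
  rewrite -integral_itv_bndo_bndc.
    rewrite [RHS]integral_mkcond; apply: eq_integral => r _.
    by rewrite /F patchE indicE; case: ifPn => _; rewrite ?mul1r ?mul0r.
  apply/measurable_EFinP/measurable_dot; apply: measurable_funTS.
    exact: (measurableT_comp mu_ (pair1_measurable x)).
  exact: (measurableT_comp mu_ (pair1_measurable x)).
apply: (@le_trans _ _ (\int[gamma s]_x ((t - s)%:E * \int[leb]_r F (x, r)))%E).
  apply: ae_ge0_le_integral => //.
  - by move=> x _; rewrite lee_fin dot_ge0.
  - exact: measurable_sq.
  - move=> x _; rewrite mule_ge0 ?lee_fin ?subr_ge0//; exact: integral_ge0.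
  - apply: measurable_funeM; exact: mFx.
  - by move: (ode_sq_le c sI tI st); apply: filterS => x h _; rewrite FE.
rewrite ge0_integralZl_EFin ?subr_ge0//; last by move=> x _; exact: integral_ge0.
have -> := @fubini_tonelli _ _ _ _ _ (gamma s) leb F mF F0.
rewrite expr2 -mulrA EFinM lee_wpmul2l ?lee_fin ?subr_ge0//.
apply: (@le_trans _ _ (\int[leb]_(r in `[s, t[) (cst K%:E r))%E); last first.
  by rewrite integral_cst// [X in (_ * X)%E](lebesgue_itvco st) -EFinM mulrC.
rewrite [leRHS]integral_mkcond.
have hr r : s <= r -> r < t -> (\int[gamma s]_x F (x, r) <= K%:E)%E.
  move=> sr rt; have rI := in_I01_between sI tI sr (ltW rt).
  have := hK r sr rt; rewrite -lee_fin -sqnormE.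
    apply: le_trans; rewrite le_eqVlt; apply/orP; left; apply/eqP.
    apply: eq_integral => x _; rewrite /F/= indicE mem_set/=; last first.
      by rewrite in_itv/= sr rt.
    by rewrite mul1r /u/= clampE.
  apply: sq_integrableB => //.
  by apply: (pushes_sq_integrable (flow_pushes sI rI)); exact: velocity_sq_integrable.
apply: ge0_le_integral => //.
- by move=> r _; exact: integral_ge0.
- apply: (measurable_restrictT _ _).1; first exact: measurable_itv.
  exact: measurable_cst.
- move=> r _; rewrite patchE; case: ifPn.
    by rewrite inE/= in_itv/= => /andP[]; exact: hr.
  move=> rn; rewrite integral0_eq// => x _; rewrite /F indicE/=.
  by rewrite (negbTE rn) mul0r.
Qed.

End flow.

(** * The metric speed bounds the velocity *)

Section couplings.
Variables (R : realType) (d : nat).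
Notation E := 'rV[R]_d.
Implicit Types (mu nu : probability E R).

(** The law of (x, T x) under mu is a coupling whose cost is the norm of T - id. *)
Lemma W2_le_pushes mu nu T : pushes mu T nu ->
  (W2 mu nu <= L2norm mu (fun x => T x - x)%R)%E.
Proof.
move=> [mT nuE]; pose f (x : E) : E * E := (x, T x).
have mf : measurable_fun setT f by exact: measurable_fun_pair.
pose mixin := isMeasurableFun.Build _ _ _ _ f mf.
pose fm : {mfun E >-> (E * E)%type} := HB.pack f mixin.
pose pi : probability (E * E)%type R := distribution mu fm.
apply: ge_ereal_inf; exists ('N[pi]_(2%:E)[EFin \o (fun z : E * E => enorm (z.1 - z.2)%R)]%E).
  by exists pi => // A mA; split => //=; rewrite nuE.
rewrite /L2norm !Lnorm2E; set a := (X in (X `^ _)%E); set b := (X in (_ <= X `^ _)%E).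
suff -> : a = b by [].
rewrite /a (@ge0_integral_image _ _ _ _ _ mu pi f)//.
- by apply: eq_integral => x _; rewrite /= -opprB dotNl dotNr opprK.
- apply: measurable_sq; apply: measurable_rVB; [exact: measurable_fst|exact: measurable_snd].
- by move=> z; rewrite lee_fin dot_ge0.
Qed.

Lemma W2_lt_coupling mu nu (c : R) : 0 <= c -> (W2 mu nu < c%:E)%E ->
  exists pi : probability (E * E)%type R, [/\ coupling mu nu pi,
    sq_integrable pi (fun z => z.2 - z.1) &
    sqnorm pi (fun z => z.2 - z.1) <= c ^+ 2].
Proof.
move=> c0 /ereal_inf_lt[_ [pi cpi <-]] /ltW; rewrite Lnorm2_le// => h.
exists pi; have [] // := @sq_integrable_le _ _ _ _ pi (fun z : E * E => z.2 - z.1) (c ^+ 2).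
  by apply: measurable_rVB; [exact: measurable_snd|exact: measurable_fst].
apply: le_trans h; rewrite le_eqVlt; apply/orP; left; apply/eqP.
by apply: eq_integral => z _; rewrite -opprB dotNl dotNr opprK.
Qed.

End couplings.

(** * Arithmetic of the speed estimate *)

Section speed_arith.
Variable R : realType.
Implicit Types M S N D d A e h Q : R.

Lemma speed_const_gt0 M S N D d : 0 <= M -> 0 <= S -> 0 <= N -> 0 <= d -> 0 <= D ->
  0 < (N + 1) + 4 * M * (S + 1) + (2 * d + 1) + 2 * M * D.
Proof.
move=> M0 S0 N0 d0 D0; have := mulr_ge0 M0 S0; have := mulr_ge0 M0 D0; lra.
Qed.

Lemma le_of_small_error a C : 0 < C ->
  (forall e, 0 < e -> e < 1 -> a <= e * C) -> a <= 0.
Proof.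
move=> C0 ha; rewrite leNgt; apply/negP => a0.
(* Makes e C at most a / 2, which contradicts a <= e C when a > 0. *)
pose e := Num.min (1 / 2) (a / (2 * C)).
have e0 : 0 < e by rewrite lt_min !divr_gt0// mulr_gt0.
have e1 : e < 1 by rewrite gt_min; apply/orP; left; lra.
have := ha e e0 e1.
have : e * C <= a / (2 * C) * C by rewrite ler_pM2r// ge_min lexx orbT.
rewrite (_ : a / (2 * C) * C = a / 2); last by field; rewrite gt_eqF.
by move=> h1 h2; have := le_trans h2 h1; lra.
Qed.

(** Q is the squared norm of the remainder of the flow after its linear part, so every error is O(h
    e + h^2). The factors 1 match the shape of [Rintegral_comb]. *)
Lemma speed_lower_arith M S N A e h Q : 0 <= M -> 0 < h -> 0 < e -> e < 1 ->
  Q <= h ^+ 2 * e ^+ 2 ->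
  h * A - (h * e / 2 * (N + 1)) - 2 * M * h ^+ 2 * (S + 1) <=
  1 * (h * A + - (h * e / 2) * N) +
    1 * (- ((2 * h * e)^-1 + 2 * M) * Q + - (2 * M * h ^+ 2) * S).
Proof.
move=> M0 h0 e0 e1 hQ.
have c0 : 0 <= (2 * h * e)^-1 + 2 * M.
  by rewrite addr_ge0 ?mulr_ge0// invr_ge0 !mulr_ge0// ltW.
have := ler_wpM2l c0 hQ.
rewrite [leRHS]mulrDl (_ : (2 * h * e)^-1 * (h ^+ 2 * e ^+ 2) = h * e / 2); last first.
  by field; rewrite !gt_eqF.
have : M * (h ^+ 2 * e ^+ 2) <= M * h ^+ 2.
  by rewrite ler_wpM2l// ler_piMr ?sqr_ge0// expr_le1// ltW.
by move: ((2 * h * e)^-1) => k; lra.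
Qed.

(** The Taylor bound for the displacement h V + Q, with AM-GM of weight h e on the pairing of the
    gradient with Q: its remainder term becomes O(h e) once Q has squared norm at most h^2 e^2. *)
Lemma speed_lower_pointwise M e h (D p gg gV gQ VV QQ : R) :
  0 <= M -> 0 < h -> 0 < e ->
  - (M * D) <= p - (h * gV + gQ) ->
  D <= 2 * (h * (h * VV)) + 2 * QQ ->
  2 * - gQ <= h * e * gg + (h * e)^-1 * QQ ->
  1 * (h * gV + - (h * e / 2) * gg) +
    1 * (- ((2 * h * e)^-1 + 2 * M) * QQ + - (2 * M * h ^+ 2) * VV) <= p.
Proof.
move=> M0 h0 e0 h1 /(ler_wpM2l M0) h2.
rewrite (_ : (2 * h * e)^-1 = (h * e)^-1 / 2); last by field; rewrite !gt_eqF.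
move: ((h * e)^-1) => k h3; lra.
Qed.

Lemma speed_final_arith M S N A e h d : 0 <= M -> 0 <= S -> 0 <= d ->
  0 < h -> 0 < e -> e < 1 -> h <= e ->
  h * A - (h * e / 2 * (N + 1)) - 2 * M * h ^+ 2 * (S + 1) <=
    h / 2 * N + h / 2 * (d + e) ^+ 2 + M * (h ^+ 2 * (d + e) ^+ 2) ->
  2 * A - N - d ^+ 2 <=
  e * ((N + 1) + 4 * M * (S + 1) + (2 * d + 1) + 2 * M * (d + 1) ^+ 2).
Proof.
move=> M0 S0 d0 h0 e0 e1 he H; rewrite -(ler_pM2l h0).
have e2 : (d + e) ^+ 2 <= d ^+ 2 + e * (2 * d + 1).
  have : e * e <= e * 1 by rewrite ler_pM2l// ltW.
  by rewrite sqrrD; lra.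
have e3 : (d + e) ^+ 2 <= (d + 1) ^+ 2.
  by rewrite ler_pXn2r ?nnegrE ?addr_ge0 ?(ltW e0)// lerD2l ltW.
have f1 := ler_wpM2l (ltW h0) e2.
have hh : h ^+ 2 <= h * e by rewrite expr2 ler_pM2l.
have f2 : M * (h ^+ 2 * (d + e) ^+ 2) <= M * ((h * e) * (d + 1) ^+ 2).
  by rewrite ler_wpM2l// ler_pM// sqr_ge0.
have f3 : h ^+ 2 * (M * (S + 1)) <= h * e * (M * (S + 1)).
  by rewrite ler_wpM2r// mulr_ge0// addr_ge0.
by move: ((d + e) ^+ 2) ((d + 1) ^+ 2) f1 f2 H => D1 D2 f1 f2 H; lra.
Qed.

End speed_arith.

Section speed.
Variables (R : realType) (d : nat).
Notation E := 'rV[R]_d.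
Notation leb := (@lebesgue_measure R).
Notation I01 := (Interval (BLeft (0:R)) (BRight (1:R))).
Variables (gamma : R -> probability E R) (V : R -> E -> E) (X : R -> R -> E -> E).
Hypothesis hV : measurable_fun ([set` I01] `*` [set: E])
  (fun p : R * E => V p.1 p.2).
Hypothesis hX : flow_maps I01 gamma V X.
Hypothesis hu : ac_tangent_field I01 gamma X V.
Variable delta : R.
Hypothesis delta0 : 0 <= delta.
Hypothesis hW : forall s t, s \in I01 -> t \in I01 -> s <= t ->
  (W2 (gamma s) (gamma t) <= ((t - s) * delta)%:E)%E.

Let hT : forall t, t \in I01 -> tangent (gamma t) (V t) := hu.1.
Let pX s t (sI : s \in I01) (tI : t \in I01) := flow_pushes hX sI tI.

Lemma velocity_pullback_sq_integrable s t : s \in I01 -> t \in I01 ->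
  sq_integrable (gamma s) (fun x => V t (X s t x)).
Proof.
move=> sI tI; apply: (pushes_sq_integrable (pX sI tI)).
exact: (velocity_sq_integrable hT).
Qed.

(** Absolute continuity of V along the flow, made uniform over pairs of times by
    [small_integral]. *)
Lemma velocity_continuity (e : R) : 0 < e ->
  exists2 h : R, 0 < h & forall s t, s \in I01 -> t \in I01 -> s <= t ->
    t - s < h -> sqnorm (gamma s) (fun x => V t (X s t x) - V s x) <= e ^+ 2.
Proof.
move=> e0; have [_ [m [im hm]]] := hu.
have [h h0 he] := small_integral im e0; exists h => // s t sI tI st tsh.
have su : sq_integrable (gamma s) (fun x => V t (X s t x) - V s x).
  apply: sq_integrableB; first exact: velocity_pullback_sq_integrable.
  exact: (velocity_sq_integrable hT).
rewrite -L2norm_le ?(ltW e0)//; apply: le_trans (hm s t sI tI st) _.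
have imst := im s t sI tI st.
rewrite -[X in (X <= _)%E]fineK; last exact: integrable_fin_num imst.
rewrite lee_fin; apply: le_trans (ler_norm _) _.
apply: le_trans (le_normr_Rintegral _ imst) _ => //.
move: sI tI; rewrite !in_itv/= => /andP[s0 _] /andP[_ t1].
exact/ltW/he.
Qed.

(* With h small, phi is integrated against gamma_{t+h} - gamma_t in two ways:
   along the flow, and along a coupling of cost at most h (delta + e).  AM-GM
   replaces all Cauchy-Schwarz inequalities. *)
Lemma speed_dual_le t phi : t \in I01 -> t < 1 -> test_function phi ->
  2 * \int[gamma t]_x dot (grad phi x) (V t x) <=
  sqnorm (gamma t) (grad phi) + delta ^+ 2.
Proof.
move=> tI t1 tphi; have [M [M0 taylor]] := test_function_taylor tphi.
have [G [G0 hG]] := grad_bounded tphi.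
have mg := measurable_grad tphi.
have mphi : measurable_fun setT phi := measurable_pderiv [::] tphi.
set A := \int[gamma t]_x _; set N := sqnorm _ _.
have sV := velocity_sq_integrable hT tI; set S := sqnorm (gamma t) (V t).
have sg : sq_integrable (gamma t) (grad phi) := sq_integrable_bounded (gamma t) mg hG.
have N0 : 0 <= N := sqnorm_ge0 _ _.
have S0 : 0 <= S := sqnorm_ge0 _ _.
(* Collects the coefficients of e left after comparing [lower] with [upper] and dividing by h /
   2. *)
pose C := (N + 1) + 4 * M * (S + 1) + (2 * delta + 1) + 2 * M * (delta + 1) ^+ 2.
have C0 : 0 < C.
  by rewrite /C; apply: speed_const_gt0 => //; exact: sqr_ge0.
suff key (e : R) : 0 < e -> e < 1 -> 2 * A - N - delta ^+ 2 <= e * C.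
  by have := le_of_small_error C0 key; rewrite !subr_le0 => //; rewrite lerBlDl.
move=> e0 e1.
have [h' h'0 hcont] := velocity_continuity e0.
(* Three constraints: V varies by at most e over a time h, t + h stays in [0, 1], and h <= e turns
   the second-order terms h^2 into O(h e). *)
pose h := Num.min (h' / 2) (Num.min (1 - t) e).
have h0 : 0 < h by rewrite !lt_min subr_gt0 t1 e0 divr_gt0.
have hh' : h < h' by apply: (@le_lt_trans _ _ (h' / 2)); [rewrite ge_min lexx|lra].
have ht : h <= 1 - t by rewrite !ge_min lexx orbT.
have he : h <= e by rewrite !ge_min lexx !orbT.
have thI : t + h \in I01.
  by move: tI; rewrite !in_itv/= => /andP[? ?]; apply/andP; split; lra.
have tth : t <= t + h by rewrite lerDl ltW.
have [] := @displacement_le _ _ _ _ _ hV hX hT t (t + h) (V t) (e ^+ 2) tI thI tth sV.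
  move=> r tr rth; apply: hcont => //; last by lra.
  exact: (in_I01_between tI thI tr (ltW rth)).
rewrite (_ : t + h - t = h); last by rewrite addrC addKr.
set Q : E -> E := (fun x => _ - h *: V t x) => sQ hQ.
have [mX _] := pX tI thI.
have gamE : \int[gamma (t + h)]_y phi y = \int[gamma t]_x phi (X t (t + h) x).
  rewrite (integral_image mX (pX tI thI).2)//.
  exact: test_function_integrable.
have lower : h * A - (h * e / 2 * (N + 1)) - 2 * M * h ^+ 2 * (S + 1) <=
    \int[gamma t]_x phi (X t (t + h) x) - \int[gamma t]_x phi x.
  have imX := test_function_integrable (gamma t) tphi mX.
  have iid := test_function_integrable (gamma t) tphi (@measurable_id _ _ _).
  rewrite -RintegralB//.
  have iA := sq_integrable_dot sg sV.
  have iAN := integrable_comb h (- (h * e / 2)) iA sg.2.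
  have iQS := integrable_comb (- ((2 * h * e)^-1 + 2 * M)) (- (2 * M * h ^+ 2)) sQ.2 sV.2.
  have eqI := Rintegral_comb 1 1 iAN iQS.
  rewrite (Rintegral_comb _ _ iA sg.2) (Rintegral_comb _ _ sQ.2 sV.2) in eqI.
  have lo := speed_lower_arith S N A M0 h0 e0 e1 hQ.
  apply: (le_trans lo).
  rewrite -[leLHS]eqI. apply: le_Rintegral => //.
  - exact: (integrable_comb 1 1 iAN iQS).
  - exact: (integrableB measurableT imX iid).
  move=> x _; have := taylor x (X t (t + h) x).
  have -> : X t (t + h) x - x = h *: V t x + Q x by rewrite /Q [RHS]addrC subrK.
  rewrite ler_norml => /andP[+ _].
  have := dotD_le (h *: V t x) (Q x).
  have := @dot_amgm _ _ (h * e) (grad phi x) (- Q x) (mulr_gt0 h0 e0).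
  rewrite dotNr [dot (- Q x) _]dotNl dotNr opprK.
  have -> : dot (h *: V t x) (h *: V t x) = h * (h * dot (V t x) (V t x)).
    by rewrite dotZl dotZr.
  have -> : dot (grad phi x) (h *: V t x + Q x) =
      h * dot (grad phi x) (V t x) + dot (grad phi x) (Q x) by rewrite dotDr dotZr.
  move=> h1 h2 h3; exact: (speed_lower_pointwise M0 h0 e0 h3 h2 h1).
have upper : \int[gamma (t + h)]_x phi x - \int[gamma t]_x phi x <=
    h / 2 * N + h / 2 * (delta + e) ^+ 2 + M * (h ^+ 2 * (delta + e) ^+ 2).
  (* The slack h e makes the inequality on the infimum strict, hence realized by some coupling. *)
  have [] := @W2_lt_coupling _ _ (gamma t) (gamma (t + h)) (h * (delta + e)).
  - by apply: mulr_ge0; [exact: ltW|apply: addr_ge0 => //; exact: ltW].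
  - apply: le_lt_trans (hW tI thI tth) _; rewrite lte_fin.
    by rewrite (_ : t + h - t = h) ?ltr_pM2l ?ltrDl// addrC addKr.
  move=> pi [cpi sD hD].
  have mf := @measurable_fst _ _ E E; have ms := @measurable_snd _ _ E E.
  have muE B : measurable B -> gamma t B = pi (fst @^-1` B).
    by move=> mB; rewrite (cpi B mB).1.
  have nuE B : measurable B -> gamma (t + h) B = pi (snd @^-1` B).
    by move=> mB; rewrite (cpi B mB).2.
  have sgp : sq_integrable pi (fun z => grad phi z.1).
    apply: (@sq_integrable_bounded _ _ _ _ pi _ G); first exact: measurableT_comp.
    by move=> z.
  have NE : sqnorm pi (fun z => grad phi z.1) = N.
    rewrite /N /sqnorm /Rintegral.
    rewrite (ge0_integral_image mf muE (measurable_sq mg))// => y.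
    by rewrite lee_fin dot_ge0.
  rewrite (integral_image ms nuE mphi); last exact: test_function_integrable.
  rewrite (integral_image mf muE mphi); last exact: test_function_integrable.
  rewrite -RintegralB//; [|exact: test_function_integrable|exact: test_function_integrable].
  (* AM-GM with weight h balances the gradient against a displacement of size h delta; both halves
     are then of order h, like the left-hand side. *)
  apply: (@le_trans _ _ (h / 2 * N + ((2 * h)^-1 + M) * sqnorm pi (fun z => z.2 - z.1))).
    rewrite -NE -Rintegral_comb; [|exact: sgp.2|exact: sD.2].
    apply: le_Rintegral => //.
    - exact: (integrableB measurableT (test_function_integrable pi tphi ms)
        (test_function_integrable pi tphi mf)).
    - exact: (integrable_comb _ _ sgp.2 sD.2).
    move=> z _; have := taylor z.1 z.2; rewrite ler_norml => /andP[_].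
    have := @dot_amgm _ _ h (grad phi z.1) (z.2 - z.1) h0.
    rewrite (_ : (2 * h)^-1 = h^-1 / 2); last by field; rewrite gt_eqF.
    move: (h^-1) => k h1 h2; lra.
  have c0 : 0 <= (2 * h)^-1 + M by rewrite addr_ge0// invr_ge0 mulr_ge0// ltW.
  have := ler_wpM2l c0 hD.
  rewrite [leRHS](_ : _ = h / 2 * (delta + e) ^+ 2 + M * (h ^+ 2 * (delta + e) ^+ 2)).
    by lra.
  by field; rewrite gt_eqF.
rewrite gamE in upper.
exact: (speed_final_arith M0 S0 delta0 h0 e0 e1 he (le_trans lower upper)).
Qed.

End speed.

(** * The geodesic moves along straight lines *)

Section sqnorm_more.
Context d' (T : measurableType d') (R : realType) (d : nat).
Variable mu : probability T R.
Implicit Types u v w : T -> 'rV[R]_d.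

Lemma sqnorm_ae_eq u v : measurable_fun setT u -> measurable_fun setT v ->
  (\forall x \ae mu, u x = v x) -> sqnorm mu u = sqnorm mu v.
Proof.
move=> mu_ mv uv; rewrite /sqnorm /Rintegral; congr fine.
apply: ge0_ae_eq_integral => //; do ?exact: measurable_sq.
- by move=> x _; rewrite lee_fin dot_ge0.
- by move=> x _; rewrite lee_fin dot_ge0.
- by apply: filterS uv => x ->.
Qed.

Lemma sqnormZ (c : R) u : sq_integrable mu u ->
  sqnorm mu (fun x => c *: u x) = c ^+ 2 * sqnorm mu u.
Proof.
move=> su; rewrite /sqnorm -RintegralZl//; last exact: su.2.
by apply: eq_Rintegral => x _; rewrite dotZl dotZr mulrA.
Qed.

Lemma sqnormB u v : sq_integrable mu u -> sq_integrable mu v ->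
  sqnorm mu (fun x => u x - v x) =
  sqnorm mu u + sqnorm mu v - 2 * \int[mu]_x dot (v x) (u x).
Proof.
move=> su sv; have ivu := sq_integrable_dot sv su.
have i1 := integrable_comb 1 1 su.2 sv.2.
transitivity (1 * (1 * sqnorm mu u + 1 * sqnorm mu v) + (- 2) * \int[mu]_x dot (v x) (u x)).
  rewrite -(Rintegral_comb 1 1 su.2 sv.2) -(Rintegral_comb 1 (- 2) i1 ivu).
  apply: eq_Rintegral => x _; rewrite dotDl !dotDr !dotNl !dotNr (dotC (u x) (v x)).
  by ring.
by ring.
Qed.

(** Strict convexity as an identity: if the norms of u, v - u and v are at most s delta, at most (1
    - s) delta and equal to delta, the right-hand side is at most 0, which forces u = s v. *)
Lemma sqnorm_interpolation (s : R) u v : sq_integrable mu u -> sq_integrable mu v ->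
  sqnorm mu (fun x => u x - s *: v x) =
  (1 - s) * sqnorm mu u + s * sqnorm mu (fun x => v x - u x) -
  s * (1 - s) * sqnorm mu v.
Proof.
move=> su sv; rewrite (sqnormB su (sq_integrableZ s sv)) (sqnormB sv su) (sqnormZ s sv).
have -> : \int[mu]_x dot (s *: v x) (u x) = s * \int[mu]_x dot (u x) (v x).
  rewrite -RintegralZl//; last exact: sq_integrable_dot.
  by apply: eq_Rintegral => x _; rewrite dotZl dotC.
by ring.
Qed.

Lemma sqnorm_small_ae0 u : sq_integrable mu u ->
  (forall e : R, 0 < e -> sqnorm mu u <= e ^+ 2) -> \forall x \ae mu, u x = 0.
Proof.
move=> su ue; apply: (sqnorm_eq0 su); apply: (@le_of_small_error _ _ 1) => // e e0 e1.
by apply: le_trans (ue e e0) _; rewrite expr2 ler_pM2l// ltW.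
Qed.

End sqnorm_more.

Section straight.
Variables (R : realType) (d : nat).
Notation E := 'rV[R]_d.
Notation leb := (@lebesgue_measure R).
Notation I01 := (Interval (BLeft (0:R)) (BRight (1:R))).
Variables (gamma : R -> probability E R) (V : R -> E -> E) (X : R -> R -> E -> E).
Hypothesis hV : measurable_fun ([set` I01] `*` [set: E])
  (fun p : R * E => V p.1 p.2).
Hypothesis hX : flow_maps I01 gamma V X.
Hypothesis hu : ac_tangent_field I01 gamma X V.
Variable delta : R.
Hypothesis delta0 : 0 <= delta.
Hypothesis hW : forall s t, s \in I01 -> t \in I01 -> s <= t ->
  (W2 (gamma s) (gamma t) <= ((t - s) * delta)%:E)%E.
Hypothesis hW1 : (delta%:E <= W2 (gamma 0%R) (gamma 1%R))%E.

Let hT : forall t, t \in I01 -> tangent (gamma t) (V t) := hu.1.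
Let pX s t (sI : s \in I01) (tI : t \in I01) := flow_pushes hX sI tI.
Let mX s t (sI : s \in I01) (tI : t \in I01) := flow_measurable hX sI tI.
Let I0 : 0 \in I01. Proof. by rewrite in_itv/= lexx ler01. Qed.
Let I1 : 1 \in I01. Proof. by rewrite in_itv/= lexx ler01. Qed.

(** Tangency enters here: with grad phi within e of V_t, expanding the squared norm of V_t - grad
    phi and inserting [speed_dual_le] leaves an error e^2. Times t < 1 leave room for a forward
    increment. *)
Lemma speed_le t : t \in I01 -> t < 1 -> sqnorm (gamma t) (V t) <= delta ^+ 2.
Proof.
move=> tI t1; rewrite -subr_le0; apply: (@le_of_small_error _ _ 1) => // e e0 e1.
have [_ /(_ e e0)[phi [tphi he]]] := hT tI.
have sV := velocity_sq_integrable hT tI.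
have [G [G0 hG]] := grad_bounded tphi.
have sg := sq_integrable_bounded (gamma t) (measurable_grad tphi) hG.
have := speed_dual_le hV hX hu delta0 hW tI t1 tphi.
move/ltW : he; rewrite L2norm_le ?(ltW e0)//; last exact: sq_integrableB.
rewrite sqnormB//.
have : e ^+ 2 <= e * 1 by rewrite expr2 ler_pM2l// ltW.
move: (sqnorm _ _) (sqnorm _ _) (\int[_]_x _) => a b c; lra.
Qed.

Lemma flow_displacement_le s t : s \in I01 -> t \in I01 -> s <= t ->
  sq_integrable (gamma s) (fun x => X s t x - x) /\
  sqnorm (gamma s) (fun x => X s t x - x) <= (t - s) ^+ 2 * delta ^+ 2.
Proof.
move=> sI tI st.
have s0 : sq_integrable (gamma s) (fun=> 0 : E).
  by apply: (@sq_integrable_bounded _ _ _ _ _ _ 0) => // x; rewrite dot0l.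
have := @displacement_le _ _ _ _ _ hV hX hT s t (fun=> 0) (delta ^+ 2) sI tI st s0.
have -> : (fun x : E => X s t x - x - (t - s) *: 0) = (fun x => X s t x - x).
  by apply/funext => x; rewrite scaler0 subr0.
apply=> r sr rt; have rI := in_I01_between sI tI sr (ltW rt).
have -> : (fun x => V r (X s r x) - 0) = (V r \o X s r).
  by apply/funext => x; rewrite subr0.
rewrite -(pushes_sqnorm (pX sI rI) (velocity_measurable hT rI)).
apply: speed_le => //; apply: lt_le_trans rt _.
by move: tI; rewrite in_itv/= => /andP[].
Qed.

Let D x := X 0 1 x - x.

Lemma displacement_sq_integrable : sq_integrable (gamma 0) D.
Proof. exact: (flow_displacement_le I0 I1 ler01).1. Qed.

(** The lower bound holds because X_{0,1} is a transport map between the endpoints, so it costs at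
    least their distance. *)
Lemma sqnorm_displacement : sqnorm (gamma 0) D = delta ^+ 2.
Proof.
have [sD] := flow_displacement_le I0 I1 ler01; rewrite subr0 expr1n mul1r => h.
apply/eqP; rewrite eq_le h/=.
have := le_trans hW1 (W2_le_pushes (pX I0 I1)).
have dE : delta = Num.sqrt (delta ^+ 2) by rewrite sqrtr_sqr ger0_norm.
by rewrite L2norm_sqrt// lee_fin [X in X <= _]dE ler_sqrt ?sqnorm_ge0.
Qed.

(* The displacements over [0, s] and [s, 1] have norms at most s delta and
   (1 - s) delta while their sum D has norm delta, so sqnorm_interpolation is an
   equality case. *)
Lemma flow_straight s : s \in I01 -> \forall x \ae gamma 0, X 0 s x = x + s *: D x.
Proof.
move=> sI; have := sI; rewrite in_itv/= => /andP[s0 s1].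
have [sa ha] := flow_displacement_le I0 sI s0.
have [sb hb] := flow_displacement_le sI I1 s1.
have sD := displacement_sq_integrable.
have hb' : sqnorm (gamma 0) (fun x => D x - (X 0 s x - x)) <= (1 - s) ^+ 2 * delta ^+ 2.
  rewrite (pushes_sqnorm (pX I0 sI) sb.1) in hb; apply: le_trans hb.
  rewrite le_eqVlt; apply/orP; left; apply/eqP; apply: sqnorm_ae_eq.
  - by apply: measurable_rVB; [exact: sD.1|exact: sa.1].
  - exact: (pushes_comp (pX I0 sI) sb.1).
  have [_ _ /(_ 0 s 1 I0 sI I1) + _] := hX.
  by apply: filterS => x /= ->; rewrite /D opprB addrA subrK.
have : \forall x \ae gamma 0, (X 0 s x - x) - s *: D x = 0.
  apply: sqnorm_eq0; first by apply: sq_integrableB => //; exact: sq_integrableZ.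
  rewrite sqnorm_interpolation// sqnorm_displacement.
  rewrite subr0 in ha.
  have s1' : 0 <= 1 - s by rewrite subr_ge0.
  have := ler_wpM2l s1' ha; have := ler_wpM2l s0 hb'.
  move: (sqnorm _ _) (sqnorm _ _) (delta ^+ 2) => a b c; lra.
apply: filterS => x /eqP; rewrite subr_eq0 subr_eq => /eqP ->.
by rewrite addrC.
Qed.

(** By straightness the flow from t to t + h moves the point X_{0,t} x by exactly h D x, while
    [displacement_le] with reference field V_t says that it moves by h V_t up to h e. Dividing by h
    leaves an error e that is arbitrary. *)
Lemma flow_velocity_lt1 t : t \in I01 -> t < 1 ->
  \forall x \ae gamma 0, V t (X 0 t x) = D x.
Proof.
move=> tI t1; have sD := displacement_sq_integrable.
have sV := velocity_pullback_sq_integrable hX hu I0 tI.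
have : \forall x \ae gamma 0, D x - V t (X 0 t x) = 0.
  apply: sqnorm_small_ae0; first exact: sq_integrableB.
  move=> e e0; have [h' h'0 hcont] := velocity_continuity hX hu e0.
  pose h := Num.min (h' / 2) (1 - t).
  have h0 : 0 < h by rewrite lt_min subr_gt0 t1 divr_gt0.
  have hh' : h < h' by apply: (@le_lt_trans _ _ (h' / 2)); [rewrite ge_min lexx|lra].
  have ht : h <= 1 - t by rewrite ge_min lexx orbT.
  have thI : t + h \in I01.
    by move: tI; rewrite !in_itv/= => /andP[? ?]; apply/andP; split; lra.
  have tth : t <= t + h by rewrite lerDl ltW.
  have sVt := velocity_sq_integrable hT tI.
  have [] := @displacement_le _ _ _ _ _ hV hX hT t (t + h) (V t) (e ^+ 2) tI thI tth sVt.
    move=> r tr rth; apply: hcont => //; last by lra.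
    exact: (in_I01_between tI thI tr (ltW rth)).
  rewrite (_ : t + h - t = h); last by rewrite addrC addKr.
  move=> sQ; rewrite (pushes_sqnorm (pX I0 tI) sQ.1).
  rewrite (@sqnorm_ae_eq _ _ _ _ _ _ (fun x => h *: (D x - V t (X 0 t x)))); first last.
  - have [_ _ /(_ 0 t (t + h) I0 tI thI) + _] := hX.
    apply: filterS3 (flow_straight tI) (flow_straight thI) => x h1 h2 /= ->.
    rewrite h2 h1 [RHS]scalerBr; congr (_ - _).
    by rewrite scalerDl addrA [LHS]addrC addKr.
  - by apply: measurable_rVZ => //; apply: measurable_rVB; [exact: sD.1|exact: sV.1].
  - exact: (pushes_comp (pX I0 tI) sQ.1).
  rewrite sqnormZ; last exact: sq_integrableB.
  by rewrite ler_pM2l// exprn_gt0.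
by apply: filterS => x /eqP; rewrite subr_eq0 => /eqP.
Qed.

(** At t = 1 there is no forward increment; the value is reached from s = 1 - h by continuity of V
    along the flow. *)
Lemma flow_velocity t : t \in I01 -> \forall x \ae gamma 0, V t (X 0 t x) = D x.
Proof.
move=> tI; have := tI; rewrite in_itv/= => /andP[_]; rewrite le_eqVlt => /predU1P[->|]; last first.
  exact: flow_velocity_lt1.
have sD := displacement_sq_integrable.
have sV := velocity_pullback_sq_integrable hX hu I0 I1.
have : \forall x \ae gamma 0, V 1 (X 0 1 x) - D x = 0.
  apply: sqnorm_small_ae0; first exact: sq_integrableB.
  move=> e e0; have [h' h'0 hcont] := velocity_continuity hX hu e0.
  pose h := Num.min (h' / 2) 1.
  have h0 : 0 < h by rewrite lt_min divr_gt0/=.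
  have hh' : h < h' by apply: (@le_lt_trans _ _ (h' / 2)); [rewrite ge_min lexx|lra].
  have h1 : h <= 1 by rewrite ge_min lexx orbT.
  pose s := 1 - h.
  have sI : s \in I01 by rewrite in_itv/= /s; apply/andP; split; lra.
  have s1 : s <= 1 by rewrite /s; lra.
  have sVs := velocity_sq_integrable hT sI.
  have sVs1 := velocity_pullback_sq_integrable hX hu sI I1.
  have mdiff := (sq_integrableB sVs1 sVs).1.
  have := hcont s 1 sI I1 s1; rewrite (_ : 1 - s = h); last by rewrite /s; lra.
  move=> /(_ hh'); rewrite (pushes_sqnorm (pX I0 sI) mdiff).
  apply: le_trans; rewrite le_eqVlt; apply/orP; left; apply/eqP; apply: sqnorm_ae_eq.
  - by apply: measurable_rVB; [exact: sV.1|exact: sD.1].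
  - exact: (pushes_comp (pX I0 sI) mdiff).
  have [_ _ /(_ 0 s 1 I0 sI I1) + _] := hX.
  have sl1 : s < 1 by rewrite /s; lra.
  by apply: filterS2 (flow_velocity_lt1 sI sl1) => x e1 /= ->; rewrite e1.
by apply: filterS => x /eqP; rewrite subr_eq0 => /eqP.
Qed.

End straight.

(** * Regularity of the geodesic velocity *)

Section ae_lemmas.
Context d' (T : measurableType d') (R : realType) (mu : {measure set T -> \bar R}).

Lemma measure_ae_eq (A B : set T) : measurable A -> measurable B ->
  (\forall x \ae mu, A x <-> B x) -> mu A = mu B.
Proof.
move=> mA mB AB; rewrite -[A]setIT -[B]setIT -!integral_indic//.
apply: ge0_ae_eq_integral => //; try by move=> x _; rewrite lee_fin.
- exact/measurable_EFinP.
- exact/measurable_EFinP.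
apply: filterS AB => x AB _; rewrite !indicE.
suff -> : (x \in A) = (x \in B) by [].
by apply/idP/idP; rewrite !inE => /AB.
Qed.

End ae_lemmas.

Section L2_zero.
Variables (R : realType) (d : nat) (mu : probability 'rV[R]_d R).

Lemma sq_integrable0 : sq_integrable mu (fun=> 0 : 'rV[R]_d).
Proof. by apply: (@sq_integrable_bounded _ _ _ _ _ _ 0) => // x; rewrite dot0l. Qed.

Lemma L2norm0 : L2norm mu (fun=> 0) = 0%E.
Proof.
rewrite L2norm_sqrt; last exact: sq_integrable0.
rewrite /sqnorm (@eq_Rintegral _ _ _ mu setT (fun=> 0)).
  by rewrite Rintegral_cst// mul0r sqrtr0.
by move=> x _; rewrite dot0l.
Qed.

Lemma tangentZ (c : R) u : tangent mu u -> tangent mu (fun x => c *: u x).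
Proof.
move=> [Lu hu]; have su := in_L2_sq_integrable Lu.
have sc := sq_integrableZ c su; split; first exact: sq_integrable_in_L2.
move=> e e0; have c1 : 0 < `|c| + 1 by rewrite ltr_wpDl.
have [phi [tphi he]] := hu (e / (`|c| + 1)) (divr_gt0 e0 c1).
have [G [G0 hG]] := grad_bounded tphi.
have sg := sq_integrable_bounded mu (measurable_grad tphi) hG.
have sd := sq_integrableB su sg.
exists (fun x => c * phi x); split; first exact: test_functionZ.
rewrite gradZ//.
have -> : (fun x => c *: u x - c *: grad phi x) = (fun x => c *: (u x - grad phi x)).
  by apply/funext => x; rewrite scalerBr.
rewrite L2norm_sqrt ?sqnormZ//; last exact: sq_integrableZ.
rewrite L2norm_sqrt// in he; rewrite !lte_fin in he *.
rewrite sqrtrM ?sqr_ge0// sqrtr_sqr.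
have -> : e = (`|c| + 1) * (e / (`|c| + 1)) by rewrite mulrC divfK// gt_eqF.
apply: (@le_lt_trans _ _ ((`|c| + 1) * Num.sqrt (sqnorm mu (fun x => u x - grad phi x)))).
  by rewrite ler_wpM2r ?sqrtr_ge0// lerDl.
by rewrite ltr_pM2l.
Qed.

End L2_zero.

Section consequences.
Variables (R : realType) (d : nat).
Notation E := 'rV[R]_d.
Notation leb := (@lebesgue_measure R).
Notation I01 := (Interval (BLeft (0:R)) (BRight (1:R))).
Variables (gamma : R -> probability E R) (V : R -> E -> E) (X : R -> R -> E -> E).
Hypothesis hV : measurable_fun ([set` I01] `*` [set: E])
  (fun p : R * E => V p.1 p.2).
Hypothesis hX : flow_maps I01 gamma V X.
Hypothesis hu : ac_tangent_field I01 gamma X V.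
Variable delta : R.
Hypothesis delta0 : 0 <= delta.
Hypothesis hW : forall s t, s \in I01 -> t \in I01 -> s <= t ->
  (W2 (gamma s) (gamma t) <= ((t - s) * delta)%:E)%E.
Hypothesis hW1 : (delta%:E <= W2 (gamma 0%R) (gamma 1%R))%E.

Let hT : forall t, t \in I01 -> tangent (gamma t) (V t) := hu.1.
Let pX s t (sI : s \in I01) (tI : t \in I01) := flow_pushes hX sI tI.
Let mX s t (sI : s \in I01) (tI : t \in I01) := flow_measurable hX sI tI.
Let I0 : 0 \in I01. Proof. by rewrite in_itv/= lexx ler01. Qed.
Let I1 : 1 \in I01. Proof. by rewrite in_itv/= lexx ler01. Qed.
Let D x := X 0 1 x - x.
Let straight s (sI : s \in I01) := flow_straight hV hX hu delta0 hW hW1 sI.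
Let velo s (sI : s \in I01) := flow_velocity hV hX hu delta0 hW hW1 sI.

Lemma measurable_eqset (u v : E -> E) : measurable_fun setT u ->
  measurable_fun setT v -> measurable [set x | u x = v x].
Proof. by move=> mu mv; rewrite -[X in measurable X]setTI; exact: measurable_eq_rV. Qed.

(** Composed with X_{0,s}, both sides equal D; [ae_image] moves this identity from gamma_0 to
    gamma_s. Passing through time 0 also covers r < s, where the ODE of [flow_maps] says nothing. *)
Lemma velocity_transport s r : s \in I01 -> r \in I01 ->
  \forall y \ae gamma s, V r (X s r y) = V s y.
Proof.
move=> sI rI; apply: (ae_image (mX I0 sI) (pX I0 sI).2).
  apply: measurable_eqset; last exact: (velocity_measurable hT).
  apply: measurableT_comp; last exact: mX.
  exact: (velocity_measurable hT).
have [_ _ /(_ 0 s r I0 sI rI) + _] := hX.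
by apply: filterS3 (velo sI) (velo rI) => x h1 h2 ->; rewrite h1 h2.
Qed.

Lemma flow_line s r : s \in I01 -> r \in I01 ->
  \forall y \ae gamma s, X s r y = y + (r - s) *: V s y.
Proof.
move=> sI rI; apply: (ae_image (mX I0 sI) (pX I0 sI).2).
  apply: measurable_eqset; first exact: mX.
  apply: measurable_rVD => //; apply: measurable_rVZ => //.
  exact: (velocity_measurable hT).
have [_ _ /(_ 0 s r I0 sI rI) + _] := hX.
move=> semi; apply: filterS3 semi (filterI (straight sI) (straight rI)) (velo sI).
move=> x /= -> [h1 h2] h3; by rewrite h3 h2 h1 -addrA -scalerDl [s + _]addrC subrK.
Qed.

Lemma sqnorm_velocity s : s \in I01 -> sqnorm (gamma s) (V s) = delta ^+ 2.
Proof.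
move=> sI; rewrite (pushes_sqnorm (pX I0 sI)); last exact: (velocity_measurable hT).
rewrite -(sqnorm_displacement hV hX hu delta0 hW hW1); apply: sqnorm_ae_eq.
- by apply: measurableT_comp; [exact: (velocity_measurable hT)|exact: mX].
- exact: (displacement_sq_integrable hV hX hu delta0 hW).1.
- exact: velo.
Qed.

(** Puts the given geodesic in the form of a displacement interpolation, for which [regular_problem]
    guarantees membership in the family. *)
Lemma pushes_interpolation s : s \in I01 ->
  pushes (gamma 0) (interpolation (X 0 1) s) (gamma s).
Proof.
move=> sI; have mi : measurable_fun setT (interpolation (X 0 1) s).
  by apply: measurable_rVD; apply: measurable_rVZ => //; exact: mX.
split=> // A mA; rewrite (pX I0 sI).2//.
have mpre (T : E -> E) : measurable_fun setT T -> measurable (T @^-1` A).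
  by move=> mT; rewrite -[X in measurable X]setTI; exact: mT.
apply: measure_ae_eq; [by apply: mpre; exact: mX|by apply: mpre|].
apply: filterS (straight sI) => x xE; rewrite /preimage/= xE.
  suff -> : interpolation (X 0 1) s x = x + s *: D x by [].
  by rewrite /interpolation /D scalerBr scalerBl scale1r addrAC -addrA.
Qed.

(** By [velocity_transport] the difference quotients of V along the flow vanish almost everywhere as
    soon as t + h lies in [0, 1]. The endpoints, where h could leave the interval, form a null set
    of times. *)
Lemma covariant_derivative_velocity :
  covariant_derivative I01 gamma X V (fun _ _ => 0).
Proof.
split=> //.
apply: filterS2 (lebesgue_ae_neq 0) (lebesgue_ae_neq 1) => t t0 t1 tI; exists (fun=> 0).
have tint : 0 < t < 1.
  by move: tI; rewrite in_itv/= => /andP[a b]; rewrite !lt_neqAle a b eq_sym t0 t1.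
have s0 := sq_integrable0 (gamma t).
have L0 := sq_integrable_in_L2 s0.
split; last first.
  split; last first.
    move=> phi tphi; rewrite (@eq_Rintegral _ _ _ (gamma t) setT (fun=> 0)).
      by rewrite Rintegral_cst// mul0r.
    by move=> x _; rewrite subr0 dot0l.
  (* The zero field is tangent as 0 times V_t. *)
  by have := tangentZ 0 (hT tI); congr tangent; apply/funext => x; rewrite scale0r.
split=> //; apply: cvg_near_cst.
have /andP[tp t1p] := tint.
have m0 : 0 < Num.min t (1 - t) by rewrite lt_min tp subr_gt0.
apply: filterS (dnbhs0_lt m0) => h; rewrite lt_min !ltr_norml => /andP[/andP[h1 h2] /andP[h3 h4]].
have thI : t + h \in I01 by rewrite in_itv/=; apply/andP; split; lra.
rewrite -(L2norm0 (gamma t)); apply: L2norm_ae_eq => //.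
  apply: measurable_rVB => //; apply: measurable_rVZ => //; apply: measurable_rVB.
    by apply: measurableT_comp; [exact: (velocity_measurable hT)|exact: mX].
  exact: (velocity_measurable hT).
apply: filterS (velocity_transport tI thI) => x ->.
by rewrite subrr scaler0 subr0.
Qed.

Hypothesis hL : lipschitz_velocity I01 gamma V.

(* Every time s lies in an interval of fixed length eta on which the integral of
   the Lipschitz constant is small, so some r there has constant at most
   K = 1 / (2 eta).  Since trajectories are straight with constant velocity, V_s
   is V_r composed with id + (r - s) V_s, and K |r - s| <= 1/2 lets the implicit
   dependence be absorbed. *)
Lemma velocity_uniformly_lipschitz : exists C : R, 0 < C /\
  forall s, s \in I01 -> exists N : set E, (gamma s).-negligible N /\
    forall x y, ~ N x -> ~ N y -> enorm (V s x - V s y) <= C * enorm (x - y).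
Proof.
have [L [iL lipL]] := hL.
have q0 : 0 < (1 / 4 : R) by lra.
have [h h0 hint] := small_integral iL q0.
pose eta := Num.min (h / 2) 1.
have eta0 : 0 < eta by rewrite lt_min divr_gt0/=.
have etah : eta < h by apply: (@le_lt_trans _ _ (h / 2)); [rewrite ge_min lexx|lra].
have eta1 : eta <= 1 by rewrite ge_min lexx orbT.
pose K := (2 * eta)^-1.
have K0 : 0 < K by rewrite invr_gt0 mulr_gt0.
have Keta : K * eta = 1 / 2 by rewrite /K; field; rewrite gt_eqF.
exists (2 * K); split; first by rewrite mulr_gt0.
move=> s sI; have := sI; rewrite in_itv/= => /andP[s0 s1].
(* The window from a to a + eta contains s and lies in [0, 1], even for s near 1. *)
pose a := Num.min s (1 - eta).
have [a0 as_ sa a1] : [/\ 0 <= a, a <= s, s <= a + eta & a + eta <= 1].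
  by rewrite /a; case: (leP s (1 - eta)) => ?; split; lra.
have aI : a \in I01 by rewrite in_itv/=; apply/andP; split; lra.
have aeI : a + eta \in I01 by rewrite in_itv/=; apply/andP; split; lra.
have aae : a <= a + eta by lra.
have iLa := iL a (a + eta) aI aeI aae.
have [r [rI ra rae [Lr [N [N0 lipN]]]]] : exists r, [/\ r \in I01, a <= r, r <= a + eta &
    L r <= K /\ exists N : set E, (gamma r).-negligible N /\
    forall x y, ~ N x -> ~ N y -> enorm (V r x - V r y) <= L r * enorm (x - y)].
  (* Otherwise |L| is at least K almost everywhere on the window, so its integral is at least K eta
     = 1/2, against the bound 1/4. *)
  apply: contrapT => noR.
  have aeK : \forall r \ae leb, [set` Interval (BLeft a) (BRight (a + eta))] r ->
      (K%:E <= (`|L r|)%:E)%E.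
    apply: filterS lipL => r lip rin; move: rin; rewrite /= in_itv/= => /andP[ra rae].
    have rI : r \in I01 by rewrite in_itv/=; apply/andP; split; lra.
    rewrite lee_fin (le_trans _ (ler_norm _))// leNgt; apply/negP => LK; apply: noR.
    by exists r; split => //; split; [exact: ltW|exact: lip].
  have iabs := integrable_norm (iLa : leb.-integrable _ (EFin \o L)).
  have : (\int[leb]_(r in `[a, (a + eta)%R]) (cst K%:E r) <=
          \int[leb]_(r in `[a, (a + eta)%R]) (`|L r|)%:E)%E.
    apply: ae_ge0_le_integral => //.
    - by move=> r _; rewrite lee_fin ltW.
    - exact: measurable_int iabs.
  rewrite integral_cst// [X in (_ * X)%E](lebesgue_itvcc aae) -EFinM.
  rewrite -[leRHS]fineK; last exact: integrable_fin_num iabs.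
  rewrite lee_fin; have tse : a + eta - a < h by lra.
  have := hint a (a + eta) a0 aae a1 tse.
  rewrite (_ : a + eta - a = eta) ?Keta; last by ring.
  by rewrite /Rintegral => h1 h2; have := le_lt_trans h2 h1; lra.
pose P y := [/\ X s r y = y + (r - s) *: V s y, V r (X s r y) = V s y & ~ N (X s r y)].
have aeP : \forall y \ae gamma s, P y.
  have NX : \forall y \ae gamma s, ~ N (X s r y).
    apply: (ae_preimage (mX sI rI) (pX sI rI).2 (P := fun y => ~ N y)).
    rewrite /= /almost_everywhere/=; apply: negligibleS N0.
    by move=> y /= /contrapT.
  by apply: filterS3 (flow_line sI rI) (velocity_transport sI rI) NX => y ? ? ?; split.
exists (~` [set y | P y]); split; first exact: aeP.
move=> x y /contrapT[x1 x2 x3] /contrapT[y1 y2 y3].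
have := lipN _ _ x3 y3; rewrite x2 y2 x1 y1.
set u := V s x - V s y; set w := x - y.
have -> : x + (r - s) *: V s x - (y + (r - s) *: V s y) = w + (r - s) *: u.
  by rewrite opprD addrACA -scalerBr.
move=> /le_trans/(_ (ler_wpM2r (sqrtr_ge0 _) Lr)).
have en0 (z : E) : 0 <= enorm z := sqrtr_ge0 _.
rewrite enorm_le; last exact: mulr_ge0 (ltW K0) (en0 _).
rewrite exprMn enorm_sqr => hu1.
rewrite enorm_le; last by rewrite !mulr_ge0// ltW.
rewrite exprMn enorm_sqr.
(* This gives |u|^2 <= 2 K^2 |w|^2 + 2 K^2 (r - s)^2 |u|^2; the last term is at most |u|^2 / 2,
   hence |u| <= 2 K |w|. *)
have := dotD_le w ((r - s) *: u); rewrite [dot (_ *: u) _]dotZl dotZr => hd.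
have rs : K ^+ 2 * (r - s) ^+ 2 <= 1 / 4.
  rewrite -exprMn (_ : 1 / 4 = (1 / 2) ^+ 2); last by field.
  rewrite -(real_normK (num_real (K * _))) normrM (gtr0_norm K0) -Keta.
  rewrite ler_pXn2r ?nnegrE ?mulr_ge0 ?(ltW K0) ?(ltW eta0)// ler_pM2l// ler_norml.
  by apply/andP; split; lra.
have h1 := ler_wpM2l (sqr_ge0 K) hd.
have h2 := ler_wpM2r (dot_ge0 u) rs.
move: (dot u u) (dot w w) (dot _ _) hu1 h1 h2 => U W Z hu1 h1 h2.
rewrite [(2 * K) ^+ 2]exprMn.
rewrite (_ : 2 ^+ 2 = 4 :> R); last by rewrite -natrX.
by move: (K ^+ 2) h1 h2 hu1 => K2 h1 h2 hu1; lra.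
Qed.

End consequences.

(** * Truncated powers *)

Section truncated_power.
Variable R : realType.
Notation leb := (@lebesgue_measure R).
Implicit Types (a s t : R) (n : nat).

(** A remainder M h^2 makes the difference quotient within M |h| of g. This covers both the kink of
    a truncated power and integrals of Taylor estimates. *)
Lemma quadratic_is_derive (G : R -> R) (s g M : R) :
  (forall h, `|h| <= 1 -> `|G (h + s) - G s - h * g| <= M * h ^+ 2) ->
  is_derive s 1 G g.
Proof.
move=> hG.
have cvgG : (fun h : R => h^-1 *: (G (h *: 1 + s) - G s)) @ 0^' --> g.
  apply/cvgrPdist_le => /= e e0; near=> h.
  have h1 : `|h| <= 1 by near: h; exact: dnbhs0_le.
  have hne : h != 0 by near: h; exact: nbhs_dnbhs_neq.
  have hM : `|h| <= e / (`|M| + 1).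
    by near: h; apply: dnbhs0_le; rewrite divr_gt0// ltr_wpDl.
  have h0 : 0 < `|h| by rewrite normr_gt0.
  rewrite [h *: 1]mulr1 -(ler_pM2l h0) -normrM mulrBr.
  rewrite [h * (h^-1 *: _)]mulrA mulfV// mul1r distrC.
  apply: le_trans (hG h h1) _.
  rewrite -(real_normK (num_real h)) expr2 mulrCA ler_pM2l//.
  have hM' : (`|M| + 1) * `|h| <= e.
    by rewrite -ler_pdivlMl ?ltr_wpDl// mulrC.
  apply: le_trans hM'; rewrite ler_wpM2r// (le_trans (ler_norm _))// lerDl//.
by split; [apply/cvg_ex; exists g|exact: cvg_lim].
Unshelve. all: by end_near. Qed.

(* For n = 0 this is the indicator of ]a, +oo[, the a.e. derivative of tpow a 1. *)
Definition tpow a n t : R := if a < t then (t - a) ^+ n else 0.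

Lemma tpow_gt a n t : a < t -> tpow a n t = (t - a) ^+ n.
Proof. by rewrite /tpow => ->. Qed.

Lemma tpow_le a n t : t <= a -> tpow a n t = 0.
Proof. by rewrite /tpow leNgt => /negbTE ->. Qed.

Lemma tpow_ge a n t : a <= t -> tpow a n.+1 t = (t - a) ^+ n.+1.
Proof.
rewrite le_eqVlt => /predU1P[<-|]; last exact: tpow_gt.
by rewrite tpow_le// subrr expr0n.
Qed.

Lemma tpow_ge0 a n t : 0 <= tpow a n t.
Proof. by rewrite /tpow; case: ltP => // at_; rewrite exprn_ge0// subr_ge0 ltW. Qed.

Lemma tpow_ub a n (H t : R) : 0 < H -> t <= a + H -> tpow a n t <= H ^+ n.
Proof.
move=> H0 tH; rewrite /tpow; case: ltP => at_; last by rewrite exprn_ge0// ltW.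
by rewrite lerXn2r ?nnegrE ?subr_ge0 ?(ltW at_) ?(ltW H0)// lerBlDl.
Qed.

Lemma measurable_tpow a n : measurable_fun setT (tpow a n).
Proof.
have -> : tpow a n = (fun t => \1_(`]a, +oo[%classic) t * (t - a) ^+ n).
  apply/funext => t; rewrite /tpow indicE; case: ltP => at_.
    by rewrite mem_set ?mul1r//= in_itv/= at_.
  by rewrite memNset ?mul0r//= in_itv/= andbT; apply/negP; rewrite -leNgt.
apply: measurable_funM; first exact: measurable_indic.
by apply: measurable_funX; exact: measurable_funB.
Qed.

Lemma is_derive_subX a n t :
  is_derive t 1 (fun u => (u - a) ^+ n.+1) (n.+1%:R * (t - a) ^+ n).
Proof.
have d1 : is_derive t 1 (fun u : R => u - a) 1.
  by rewrite -[X in is_derive _ _ _ X](subr0 1); apply: is_deriveB.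
have -> : (fun u => (u - a) ^+ n.+1) = (fun u : R => u - a) ^+ n.+1.
  by apply/funext => u; rewrite exprfctE.
by apply: is_derive_eq (is_deriveX n.+1 d1) _; rewrite /= [_ *: _]mulr1.
Qed.

Lemma is_derive_tpow_neq a n t : t != a ->
  is_derive t 1 (tpow a n.+1) (n.+1%:R * tpow a n t).
Proof.
case: (ltgtP t a) => // ta _.
  have e : \forall u \near t, cst 0 u = tpow a n.+1 u.
    near=> u; rewrite tpow_le// ltW//; near: u; exact: lt_nbhsl.
  rewrite tpow_le ?(ltW ta)// mulr0; split.
    by apply: near_eq_derivable e _; exact: derivable_cst.
  by rewrite -(near_eq_derive _ e) derive_cst.
have e : \forall u \near t, (fun u => (u - a) ^+ n.+1) u = tpow a n.+1 u.
  near=> u; rewrite tpow_gt//; near: u; exact: lt_nbhsr.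
have [d1 d2] := is_derive_subX a n t.
rewrite tpow_gt//; split; first exact: near_eq_derivable e d1.
by rewrite -(near_eq_derive _ e).
Unshelve. all: by end_near. Qed.

(** At the kink the function is bounded by h^2 for |h| <= 1, the exponent being at least 2. *)
Lemma is_derive_tpow a n t :
  is_derive t 1 (tpow a n.+2) (n.+2%:R * tpow a n.+1 t).
Proof.
have [->|] := eqVneq t a; last exact: is_derive_tpow_neq.
apply: (@quadratic_is_derive _ _ _ 1) => h h1.
have e m : tpow a m a = 0 by rewrite tpow_le.
rewrite !e !mulr0 !subr0 mul1r.
have [h0|h0] := leP h 0.
  by rewrite tpow_le ?normr0 ?sqr_ge0// gerDr.
rewrite tpow_gt ?ltrDr// addrK ger0_norm ?exprn_ge0 ?(ltW h0)//.
rewrite -(subnKC (isT : 2 <= n.+2)%N) exprD ler_piMr ?sqr_ge0//.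
by rewrite exprn_ile1// ?(ltW h0)//; rewrite gtr0_norm in h1.
Qed.

Lemma tpow_homo a n : {homo tpow a n.+1 : s t / s <= t}.
Proof.
move=> s t st; have [sa|as_] := leP s a; first by rewrite tpow_le// tpow_ge0.
rewrite !tpow_gt ?(lt_le_trans as_ st)// lerXn2r ?nnegrE ?subr_ge0 ?lerB//.
  exact: ltW.
exact: ltW (lt_le_trans as_ st).
Qed.

Lemma exprB_le n (H x y : R) : 0 <= x -> x <= y -> y <= H ->
  y ^+ n.+1 - x ^+ n.+1 <= n.+1%:R * H ^+ n * (y - x).
Proof.
move=> x0 xy yH; rewrite subrXX mulrC ler_wpM2r ?subr_ge0//.
apply: (@le_trans _ _ (\sum_(i < n.+1) H ^+ n)); last first.
  by rewrite sumr_const card_ord -[leLHS]mulr_natl.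
apply: ler_sum => i _; have y0 := le_trans x0 xy; have H0 := le_trans y0 yH.
have -> : H ^+ n = H ^+ (n.+1 - i.+1) * H ^+ i.
  by rewrite -exprD subSS subnK//; exact: (ltn_ord i).
apply: ler_pM; rewrite ?exprn_ge0// lerXn2r ?nnegrE//; exact: le_trans yH.
Qed.

Lemma tpow_lipschitz a n (H s t : R) : 0 < H -> s <= t -> t <= a + H ->
  tpow a n.+1 t - tpow a n.+1 s <= n.+1%:R * H ^+ n * (t - s).
Proof.
move=> H0 st tH; have c0 : 0 <= n.+1%:R * H ^+ n by rewrite mulr_ge0// exprn_ge0 ?ltW.
have [ta|at_] := leP t a.
  by rewrite !tpow_le ?(le_trans st)// subrr mulr_ge0// subr_ge0.
have tH' : t - a <= H by rewrite lerBlDl.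
have [sa|as_] := leP s a.
  rewrite tpow_gt// [tpow a _ s]tpow_le//.
  have := @exprB_le n H 0 (t - a) (lexx _) _ tH'.
  rewrite subr_ge0 (ltW at_) expr0n/= !subr0 => /(_ isT) h; apply: le_trans h _.
  by rewrite ler_wpM2l// lerB.
rewrite !tpow_gt//; have := @exprB_le n H (s - a) (t - a) _ _ tH'.
rewrite subr_ge0 (ltW as_) lerB// => /(_ isT isT).
by rewrite (_ : t - a - (s - a) = t - s)//; ring.
Qed.

Lemma continuous_tpow a n : continuous (tpow a n.+1).
Proof.
(* A power of the positive part of t - a, written without case distinction. *)
have -> : tpow a n.+1 = (fun t => ((`|t - a| + (t - a)) / 2) ^+ n.+1).
  apply/funext => t; have [ta|at_] := leP t a.
    by rewrite tpow_le// ler0_norm ?subr_le0// addNr mul0r expr0n.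
  by rewrite tpow_gt// gtr0_norm ?subr_gt0// -mulr2n -[_ *+ 2]mulr_natr mulfK.
move=> t; apply: (@continuous_comp _ _ _ (fun u : R => (`|u - a| + (u - a)) / 2)
  (fun x : R => x ^+ n.+1)); last exact: exprn_continuous.
have cB : (fun u : R => u - a) @ t --> t - a by exact: (cvgB cvg_id (cvg_cst a)).
apply: cvgM; last exact: cvg_cst.
by apply: cvgD => //; exact: (cvg_norm cB).
Qed.

Lemma abs_continuous_lipschitz (I : interval R) (D : R -> R -> \bar R) (C : R) :
  (forall s t, s \in I -> t \in I -> s <= t -> (D s t <= (C * (t - s))%:E)%E) ->
  abs_continuous_on I D.
Proof.
move=> hD; exists (cst C); split.
  by move=> a b _ _ _; exact: integrable_cst_itv.
move=> s t sI tI st; apply: le_trans (hD s t sI tI st) _.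
rewrite (eq_integral (cst C%:E))// integral_cst//.
by rewrite [X in (_ * X)%E](lebesgue_itvcc st) -EFinM.
Qed.

End truncated_power.

(** * Potentials along straight lines *)

Section line_potential.
Variables (R : realType) (d : nat).
Notation E := 'rV[R]_d.
Notation leb := (@lebesgue_measure R).
Variables (mu : probability E R) (D : E -> E) (phi : E -> R).
Hypothesis sD : sq_integrable mu D.
Hypothesis tphi : test_function phi.

Let line (s : R) (x : E) : E := x + s *: D x.

Let mline s : measurable_fun setT (line s).
Proof. by apply: measurable_rVD => //; apply: measurable_rVZ => //; exact: sD.1. Qed.

(** Written with the lines id + s D instead of the geodesic, the integral makes sense for every real
    s, so it is differentiable on the whole line with no one-sided derivatives at 0 and 1. *)
Definition potential_along (s : R) : R := \int[mu]_x phi (x + s *: D x).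
Definition slope_along (s : R) : R := \int[mu]_x dot (D x) (grad phi (x + s *: D x)).

Let sgrad s : sq_integrable mu (fun x => grad phi (line s x)).
Proof.
have [G [G0 hG]] := grad_bounded tphi.
apply: (@sq_integrable_bounded _ _ _ _ mu _ G) => //.
by apply: measurableT_comp => //; exact: measurable_grad.
Qed.

Lemma potential_is_derive (s : R) : is_derive s 1 potential_along (slope_along s).
Proof.
have [M [M0 taylor]] := test_function_taylor tphi.
apply: (@quadratic_is_derive _ _ _ _ (M * sqnorm mu D)) => h _.
have i1 := test_function_integrable mu tphi (mline (h + s)).
have i2 := test_function_integrable mu tphi (mline s).
have i3 := sq_integrable_dot sD (sgrad s).
have i12 := integrable_comb 1 (-1) i1 i2.
have -> : potential_along (h + s) - potential_along s - h * slope_along s =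
    1 * (1 * potential_along (h + s) + (-1) * potential_along s) + (- h) * slope_along s.
  by ring.
have iall := integrable_comb 1 (- h) i12 i3.
rewrite -(Rintegral_comb 1 (-1) i1 i2) -(Rintegral_comb 1 (- h) i12 i3).
apply: le_trans (le_normr_Rintegral _ iall) _ => //.
have iMD : mu.-integrable setT (EFin \o (fun x => M * h ^+ 2 * dot (D x) (D x))).
  exact: (integrableZl measurableT (M * h ^+ 2) sD.2).
rewrite (_ : M * sqnorm mu D * h ^+ 2 = M * h ^+ 2 * sqnorm mu D); last by ring.
rewrite -RintegralZl//; last exact: sD.2.
apply: le_Rintegral => //; first exact: integrable_norm.
move=> x _; have := taylor (line s x) (line (h + s) x).
have -> : line (h + s) x - line s x = h *: D x.
  by rewrite /line opprD addrACA subrr add0r -scalerBl addrK.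
rewrite [dot (grad _ _) _]dotZr dotZl dotZr (dotC (grad _ _)) => h1.
rewrite (_ : M * (h * (h * dot (D x) (D x))) = M * h ^+ 2 * dot (D x) (D x)) in h1;
  last by ring.
apply: le_trans h1; rewrite le_eqVlt; apply/orP; left; apply/eqP; congr (`|_|).
by rewrite /line /=; ring.
Qed.

Lemma slope_continuous : continuous slope_along.
Proof.
have [M [M0 lip]] := test_function_grad_lipschitz tphi.
move=> s; apply/cvgrPdist_le => /= e e0.
have S0 := sqnorm_ge0 mu D.
have C0 : 0 < M * sqnorm mu D + 1 by rewrite ltr_wpDl// mulr_ge0.
near=> t.
have st : `|s - t| <= e / (M * sqnorm mu D + 1).
  by near: t; apply: cvgr_dist_le => //; exact: divr_gt0.
have is_ := sq_integrable_dot sD (sgrad s).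
have it := sq_integrable_dot sD (sgrad t).
rewrite -RintegralB//.
have ist := integrableB measurableT is_ it.
apply: le_trans (le_normr_Rintegral _ (ist : mu.-integrable _ (EFin \o _))) _ => //.
apply: (@le_trans _ _ (\int[mu]_x (M * `|s - t| * dot (D x) (D x)))).
  apply: le_Rintegral => //; first exact: (integrable_norm ist).
    exact: (integrableZl measurableT (M * `|s - t|) sD.2).
  by move=> x _; exact: lip.
rewrite RintegralZl//; last exact: sD.2.
rewrite mulrAC; apply: (@le_trans _ _ ((M * sqnorm mu D + 1) * `|s - t|)).
  by rewrite ler_wpM2r// lerDl.
by rewrite mulrC -ler_pdivlMr.
Unshelve. all: by end_near. Qed.

End line_potential.

(** * Change of variables along a truncated power *)

Section substitution.
Variables (R : realType) (G g : R -> R) (a0 C : R) (k : nat).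
Notation leb := (@lebesgue_measure R).
Hypothesis dG : forall s : R, is_derive s 1 G (g s).
Hypothesis cg : continuous g.
Let p (t : R) : R := C * (t - a0) ^+ k.+1.
Let dp (t : R) : R := C * k.+1%:R * (t - a0) ^+ k.
Let sigma (t : R) : R := C * tpow a0 k.+1 t.
Let F (t : R) : R := C * k.+1%:R * tpow a0 k t * g (sigma t).

Let is_derive_p (t : R) : is_derive t 1 p (dp t).
Proof.
have := is_deriveZ C (is_derive_subX a0 k t).
by rewrite /dp -mulrA.
Qed.

Let cvg_p : continuous p.
Proof.
move=> t; apply/differentiable_continuous/derivable1_diffP.
exact: (@ex_derive _ _ _ _ _ _ _ (is_derive_p t)).
Qed.

Let dp_continuous : continuous dp.
Proof.
move=> t; have c1 : (fun u : R => (u - a0) ^+ k) @ t --> (t - a0) ^+ k.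
  case: k => [|n]; first exact: cvg_cst.
  have : {for t, continuous (fun u : R => (u - a0) ^+ n.+1)}; last by [].
  apply/differentiable_continuous/derivable1_diffP.
  exact: (@ex_derive _ _ _ _ _ _ _ (is_derive_subX a0 n t)).
exact: (cvgM (cvg_cst (C * k.+1%:R)) c1).
Qed.

Let substitution_gt a b : a0 <= a -> a <= b ->
  \int[leb]_(t in `[a, b]) (dp t * g (p t)) =
  G (p b) - G (p a).
Proof.
move=> a0a; rewrite le_eqVlt => /predU1P[->|ab].
  by rewrite set_itv1 Rintegral_set1 subrr.
have cGp : continuous (G \o p).
  move=> t; apply/differentiable_continuous/derivable1_diffP.
  exact: (@ex_derive _ _ _ _ _ _ _
    (is_derive1_comp (dG (p t)) (is_derive_p t))).
have cf : continuous (fun t => dp t * g (p t)).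
  move=> t; apply: cvgM; first exact: dp_continuous.
  exact: (continuous_comp (@cvg_p t) (@cg (p t))).
rewrite /Rintegral (@continuous_FTC2 _ _ (G \o p))//.
- exact: continuous_subspaceT.
- split.
  + move=> t _; exact: (@ex_derive _ _ _ _ _ _ _
      (is_derive1_comp (dG (p t)) (is_derive_p t))).
  + exact/cvg_at_right_filter/cGp.
  + exact/cvg_at_left_filter/cGp.
move=> t _; rewrite derive1E; apply: derive_val.
by rewrite mulrC; exact: is_derive1_comp (dG (p t)) (is_derive_p t).
Qed.

Let substitution_ge a b : a0 <= a -> a <= b ->
  \int[leb]_(t in `[a, b]) F t = G (sigma b) - G (sigma a).
Proof.
move=> a0a ab; have a0b := le_trans a0a ab.
have mg : measurable_fun setT g.
  exact: continuous_measurable_fun cg.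
have mF (D' : set R) : measurable_fun D' F.
  apply: measurable_funTS; apply: measurable_funM.
    by apply: measurable_funM => //; exact: measurable_tpow.
  apply: measurableT_comp => //; apply: measurable_funM => //; exact: measurable_tpow.
have mp (D' : set R) : measurable_fun D' (fun t => dp t * g (p t)).
  apply: measurable_funTS; apply: measurable_funM.
    exact: continuous_measurable_fun dp_continuous.
  by apply: measurableT_comp => //; exact: continuous_measurable_fun cvg_p.
rewrite /sigma !tpow_ge// -substitution_gt// /Rintegral.
(* The left endpoint is removed because for k = 0 and a = a0 the two integrands may differ there:
   [tpow a0 0 a0] is 0, while the polynomial factor is 1. *)
congr fine; transitivity (\int[leb]_(t in `]a, b]) (F t)%:E)%E.
  by rewrite integral_itv_obnd_cbnd//; apply/measurable_EFinP; exact: mF.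
rewrite -integral_itv_obnd_cbnd; last by apply/measurable_EFinP; exact: mp.
apply: eq_integral => t; rewrite inE/= in_itv/= => /andP[at_ _].
by rewrite /F /sigma !tpow_gt// (le_lt_trans a0a).
Qed.

(** For k = 0 the time change has a corner at a0, so the fundamental theorem is applied to the
    polynomial p on the right of a0. On the left, the integrand vanishes and sigma is constantly
    0. *)
Lemma integral_substitution_tpow a b : a <= b ->
  \int[leb]_(t in `[a, b]) (C * k.+1%:R * tpow a0 k t * g (C * tpow a0 k.+1 t)) =
  G (C * tpow a0 k.+1 b) - G (C * tpow a0 k.+1 a).
Proof.
move=> ab; rewrite -/(sigma a) -/(sigma b).
have [a0a|aa0] := leP a0 a; first exact: substitution_ge.
have sa : sigma a = 0 by rewrite /sigma tpow_le ?mulr0// ltW.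
have [ba0|a0b] := leP b a0.
  have -> : sigma b = 0 by rewrite /sigma tpow_le ?mulr0.
  rewrite sa subrr (@eq_Rintegral _ _ _ leb _ (fun=> 0)).
    by rewrite Rintegral_cst_itv ?mul0r.
  move=> t; rewrite inE/= in_itv/= => /andP[_ tb].
  by rewrite tpow_le ?mulr0 ?mul0r// (le_trans tb).
have -> : sigma a = sigma a0 by rewrite sa /sigma tpow_le ?mulr0.
rewrite -(substitution_ge (lexx a0) (ltW a0b)) [LHS]Rintegral_mkcond [RHS]Rintegral_mkcond.
apply: eq_Rintegral => t _; rewrite !patchE !mem_setE !in_itv/=.
have [a0t|ta0] := leP a0 t; first by rewrite (ltW (lt_le_trans aa0 a0t)).
rewrite /F /=; case: ifP => // _; by rewrite tpow_le ?mulr0 ?mul0r// ltW.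
Qed.

End substitution.

(** * The reparametrized geodesic *)

Section fubini_ae.
Context d1 d2 (T1 : measurableType d1) (T2 : measurableType d2) (R : realType).
Variables (mu : {sigma_finite_measure set T1 -> \bar R})
          (nu : {sigma_finite_measure set T2 -> \bar R}).

(** By Tonelli the double integral of q is 0, and it can be read in the other order. *)
Lemma ae_swap (q : T1 * T2 -> R) : measurable_fun setT q -> (forall z, 0 <= q z) ->
  (forall y, \forall x \ae mu, q (x, y) = 0) ->
  \forall x \ae mu, \forall y \ae nu, q (x, y) = 0.
Proof.
move=> mq q0 hq; pose F z := (q z)%:E.
have mF : measurable_fun setT F by exact/measurable_EFinP.
have F0 z : (0 <= F z)%E by rewrite lee_fin.
have mFx : measurable_fun setT (fun x => \int[nu]_y F (x, y))%E.
  exact: (@measurable_fun_fubini_tonelli_F _ _ _ _ _ nu F mF F0).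
have Fx0 x : (0 <= \int[nu]_y F (x, y))%E by exact: integral_ge0.
have : (\int[mu]_x `|\int[nu]_y F (x, y)| = 0)%E.
  under eq_integral do rewrite gee0_abs//.
  have -> := @fubini_tonelli _ _ _ _ _ mu nu F mF F0.
  apply: integral0_eq => y _.
  have mFy : measurable_fun setT (fun x => F (x, y)).
    exact: (measurableT_comp mF (pair2_measurable y)).
  rewrite (ge0_ae_eq_integral (g := cst 0%E) measurableT mFy)//; first by rewrite integral0.
  by apply: filterS (hq y) => x qx _; rewrite /F qx.
move=> /(ae_eq_integral_abs mu measurableT mFx).1; apply: filterS => x /(_ I) /= h.
have mFxy : measurable_fun setT (fun y => F (x, y)).
  exact: (measurableT_comp mF (pair1_measurable x)).
have : (\int[nu]_y `|F (x, y)| = 0)%E.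
  by rewrite -[RHS]h; apply: eq_integral => y _; rewrite gee0_abs.
move=> /(ae_eq_integral_abs nu measurableT mFxy).1; apply: filterS => y /(_ I).
by move=> [].
Qed.

End fubini_ae.

Lemma Rintegral_ae_eq d' (T : measurableType d') (R : realType)
    (mu : {measure set T -> \bar R}) (D : set T) (f g : T -> R) : measurable D ->
  measurable_fun D f -> measurable_fun D g ->
  (\forall x \ae mu, D x -> f x = g x) ->
  \int[mu]_(x in D) f x = \int[mu]_(x in D) g x.
Proof.
move=> mD mf mg fg; rewrite /Rintegral; congr fine.
apply: ae_eq_integral => //; try exact/measurable_EFinP.
by apply: filterS fg => x fg Dx; rewrite fg.
Qed.

Lemma integrable_ae_eq d' (T : measurableType d') (R : realType)
    (mu : {measure set T -> \bar R}) (D : set T) (f g : T -> R) : measurable D ->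
  measurable_fun D f -> mu.-integrable D (EFin \o g) ->
  (\forall x \ae mu, D x -> f x = g x) -> mu.-integrable D (EFin \o f).
Proof.
move=> mD mf ig fg; have mg := measurable_int _ ig; have [_ hg] := integrableP _ _ _ ig.
apply/integrableP; split; first exact/measurable_EFinP.
rewrite (ge0_ae_eq_integral (g := fun x => `|(g x)%:E|%E))//.
- by apply: measurableT_comp => //; exact/measurable_EFinP.
- exact: measurableT_comp.
- by apply: filterS fg => x fg Dx; rewrite /= fg.
Qed.

Section reparametrization.
Variables (R : realType) (d : nat).
Notation E := 'rV[R]_d.
Notation leb := (@lebesgue_measure R).
Notation I01 := (Interval (BLeft (0:R)) (BRight (1:R))).
Variables (gamma : R -> probability E R) (V : R -> E -> E) (X : R -> R -> E -> E).
Hypothesis hV : measurable_fun ([set` I01] `*` [set: E])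
  (fun p : R * E => V p.1 p.2).
Hypothesis hX : flow_maps I01 gamma V X.
Hypothesis hu : ac_tangent_field I01 gamma X V.
Variable delta : R.
Hypothesis delta0 : 0 <= delta.
Hypothesis hW : forall s t, s \in I01 -> t \in I01 -> s <= t ->
  (W2 (gamma s) (gamma t) <= ((t - s) * delta)%:E)%E.
Hypothesis hW1 : (delta%:E <= W2 (gamma 0%R) (gamma 1%R))%E.
Variables (H a0 : R) (k : nat).
Hypothesis H0 : 0 < H.

Let I := Interval -oo%O (BRight (a0 + H)).
Let c : R := (H^-1) ^+ k.+1.
Definition timechange (t : R) : R := c * tpow a0 k.+1 t.
(* The (j+1)-st derivative of timechange (almost everywhere if j = k). *)
Definition rate (j : nat) (t : R) : R := c * ((k.+1) ^_ j.+1)%:R * tpow a0 (k - j) t.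
Let sigma := timechange.
Let w j t x := rate j t *: V (sigma t) x.
(** Equal to (k+1) / H, the maximum of [rate 0] on I, attained at the final time. *)
Let B : R := c * k.+1%:R * H ^+ k.

Let hT : forall t, t \in I01 -> tangent (gamma t) (V t) := hu.1.
Let pX s t (sI : s \in I01) (tI : t \in I01) := flow_pushes hX sI tI.
Let mX s t (sI : s \in I01) (tI : t \in I01) := flow_measurable hX sI tI.
Let I0 : 0 \in I01. Proof. by rewrite in_itv/= lexx ler01. Qed.
Let D (x : E) : E := X 0 1 x - x.
Let sD : sq_integrable (gamma 0) D := displacement_sq_integrable hV hX hu delta0 hW.

Let c0 : 0 < c. Proof. by rewrite exprn_gt0// invr_gt0. Qed.
Let inI t : (t \in I) = (t <= a0 + H). Proof. by rewrite in_itv. Qed.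

Lemma timechange_itv t : t \in I -> sigma t \in I01.
Proof.
rewrite inI => tH; rewrite in_itv/= mulr_ge0 ?tpow_ge0 ?(ltW c0)//=.
apply: (@le_trans _ _ (c * H ^+ k.+1)); first by rewrite ler_pM2l// tpow_ub.
by rewrite /c -exprMn mulVf ?gt_eqF// expr1n.
Qed.

Lemma timechange_homo : {homo sigma : s t / s <= t}.
Proof. by move=> s t st; rewrite ler_pM2l// tpow_homo. Qed.

Lemma timechange_start t : t <= a0 -> sigma t = 0.
Proof. by move=> ta; rewrite /sigma /timechange tpow_le ?mulr0. Qed.

Lemma timechange_end : sigma (a0 + H) = 1.
Proof.
rewrite /sigma /timechange tpow_gt ?ltrDl// addrAC subrr add0r /c -exprMn.
by rewrite mulVf ?gt_eqF// expr1n.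
Qed.

Lemma timechange_lipschitz s t : s <= t -> t \in I -> sigma t - sigma s <= B * (t - s).
Proof.
move=> st; rewrite inI => tH; rewrite /sigma /timechange -mulrBr /B -!mulrA ler_pM2l//.
by rewrite mulrA tpow_lipschitz.
Qed.

Lemma measurable_timechange : measurable_fun setT sigma.
Proof. by apply: measurable_funM => //; exact: measurable_tpow. Qed.

Lemma rate_ge0 j t : 0 <= rate j t.
Proof. by rewrite !mulr_ge0 ?tpow_ge0 ?(ltW c0). Qed.

Lemma rate0E t : rate 0 t = c * k.+1%:R * tpow a0 k t.
Proof. by rewrite /rate ffactn1 subn0. Qed.

Lemma rate0_le t : t \in I -> rate 0 t <= B.
Proof.
rewrite inI => tH; rewrite rate0E ler_wpM2l ?mulr_ge0 ?(ltW c0)//.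
exact: tpow_ub.
Qed.

Lemma measurable_rate j : measurable_fun setT (rate j).
Proof. by apply: measurable_funM => //; exact: measurable_tpow. Qed.

Lemma rate_last t : rate k t <= c * (k.+1)`!%:R.
Proof.
rewrite /rate ffactnn subnn -[leRHS]mulr1 ler_wpM2l ?mulr_ge0 ?(ltW c0)//.
by rewrite /tpow expr0; case: ifP.
Qed.

Let wE j t : w j t = (fun x => rate j t *: V (sigma t) x). Proof. by []. Qed.

Let sV t (tI : t \in I) : sq_integrable (gamma (sigma t)) (V (sigma t)) :=
  velocity_sq_integrable hT (timechange_itv tI).

Lemma L2norm_rate j t : t \in I ->
  L2norm (gamma (sigma t)) (w j t) = (rate j t * delta)%:E.
Proof.
move=> tI; rewrite L2norm_sqrt; last exact/sq_integrableZ/sV.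
rewrite sqnormZ; last exact: sV.
rewrite (sqnorm_velocity hV hX hu delta0 hW hW1 (timechange_itv tI)) -exprMn.
by rewrite sqrtr_sqr ger0_norm// mulr_ge0// rate_ge0.
Qed.

Lemma potential_along_geodesic phi s : test_function phi -> s \in I01 ->
  \int[gamma s]_x phi x = potential_along (gamma 0) D phi s.
Proof.
move=> tphi sI; have mphi : measurable_fun setT phi := measurable_pderiv [::] tphi.
rewrite (integral_image (mX I0 sI) (pX I0 sI).2 mphi).
  apply: Rintegral_ae_eq => //.
  - by apply: measurableT_comp => //; exact: mX.
  - apply: measurableT_comp => //; apply: measurable_rVD => //.
    by apply: measurable_rVZ => //; exact: sD.1.
  by apply: filterS (flow_straight hV hX hu delta0 hW hW1 sI) => x ->.
exact: (test_function_integrable _ tphi (mX I0 sI)).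
Qed.

Lemma slope_along_geodesic phi s : test_function phi -> s \in I01 ->
  \int[gamma s]_x dot (V s x) (grad phi x) = slope_along (gamma 0) D phi s.
Proof.
move=> tphi sI; have mg := measurable_grad tphi; have [G [G0 hG]] := grad_bounded tphi.
have mVs := velocity_measurable hT sI.
have sVX := velocity_pullback_sq_integrable hX hu I0 sI.
have mgX : measurable_fun setT (fun x => grad phi (X 0 s x)).
  by apply: measurableT_comp => //; exact: mX.
have sgX := sq_integrable_bounded (gamma 0) mgX (fun x => hG (X 0 s x)).
rewrite (integral_image (mX I0 sI) (pX I0 sI).2 (measurable_dot mVs mg)).
  apply: Rintegral_ae_eq => //.
  - exact: (measurable_dot sVX.1 mgX).
  - apply: measurable_dot; first exact: sD.1.
    apply: measurableT_comp => //; apply: measurable_rVD => //.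
    by apply: measurable_rVZ => //; exact: sD.1.
  apply: filterS2 (flow_straight hV hX hu delta0 hW hW1 sI)
    (flow_velocity hV hX hu delta0 hW hW1 sI) => x h1 h2 _.
  by rewrite h2 h1.
exact: (sq_integrable_dot sVX sgX).
Qed.

(** Both sides become increments of [potential_along] at sigma, whose derivative is [slope_along];
    the rate is the factor sigma' of the substitution. *)
Lemma reparam_continuity_equation : continuity_equation I (gamma \o sigma) (w 0).
Proof.
move=> phi tphi a b aI bI ab.
rewrite /= !potential_along_geodesic ?timechange_itv//.
transitivity (\int[leb]_(t in `[a, b])
    (c * k.+1%:R * tpow a0 k t * slope_along (gamma 0) D phi (c * tpow a0 k.+1 t))).
  by rewrite (@integral_substitution_tpow _ _ _ _ _ _
    (potential_is_derive sD tphi) (slope_continuous sD tphi)).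
apply: eq_Rintegral => t; rewrite inE/= in_itv/= => /andP[_ tb].
have tI : t \in I by move: bI; rewrite !inI; exact: le_trans.
have [G [G0 hG]] := grad_bounded tphi.
have sg := sq_integrable_bounded (gamma (sigma t)) (measurable_grad tphi) hG.
rewrite -/(sigma t) -slope_along_geodesic ?timechange_itv// -rate0E -RintegralZl//.
  by apply: eq_Rintegral => x _; rewrite dotZl.
exact: (sq_integrable_dot (sV tI) sg).
Qed.

Lemma reparam_velocity_field : velocity_field I (gamma \o sigma) (w 0).
Proof.
split.
- apply: (eq_measurable_fun (fun p : R * E => rate 0 p.1 *: V (clamp (sigma p.1)) p.2)).
    by move=> p; rewrite inE => -[/= pI _]; rewrite wE clampE ?timechange_itv.
  have mc : measurable_fun setT (fun p : R * E => clamp (sigma p.1)).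
    apply: (measurableT_comp (@measurable_clamp R)).
    by apply: measurableT_comp measurable_fst; exact: measurable_timechange.
  apply: measurable_funTS; apply: measurable_rVZ.
    by apply: measurableT_comp measurable_fst; exact: measurable_rate.
  by apply: (measurable_velocity_comp hV) => // p; exact: clamp_itv.
- move=> a b aI bI ab.
  have abI t : [set` Interval (BLeft a) (BRight b)] t -> t \in I.
    by rewrite /= in_itv/= => /andP[_ tb]; move: bI; rewrite !inI; exact: le_trans.
  have -> : (\int[leb]_(t in `[a, b]) L2norm ((gamma \o sigma) t) (w 0 t) =
      \int[leb]_(t in `[a, b]) (rate 0 t * delta)%:E)%E.
    by apply: eq_integral => t; rewrite inE => /abI tI; rewrite L2norm_rate.
  apply: (@le_lt_trans _ _ (\int[leb]_(t in `[a, b]) (cst (B * delta)%:E t))%E).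
    apply: ge0_le_integral => //.
    + by move=> t _; rewrite lee_fin mulr_ge0// rate_ge0.
    + apply/measurable_EFinP; apply: measurable_funTS.
      by apply: measurable_funM => //; exact: measurable_rate.
    + by move=> t /abI tI; rewrite lee_fin ler_wpM2r// rate0_le.
  by rewrite integral_cst// [X in (_ * X)%E](lebesgue_itvcc ab) -EFinM ltry.
- exact: reparam_continuity_equation.
- by apply: aeW => t tI; apply: tangentZ; exact: (hT (timechange_itv tI)).
Qed.

(** With a Lipschitz constant uniform in time, boundedness of the rate alone gives an integrable
    modulus for the new velocity. *)
Lemma reparam_lipschitz : lipschitz_velocity I01 gamma V ->
  lipschitz_velocity I (gamma \o sigma) (w 0).
Proof.
move=> hL; have [C [C0 hC]] := velocity_uniformly_lipschitz hV hX hu delta0 hW hW1 hL.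
exists (cst (B * C)); split; first by move=> a b _ _ _; exact: integrable_cst_itv.
apply: aeW => t tI; have [N [N0 lipN]] := hC _ (timechange_itv tI).
exists N; split=> // x y Nx Ny; have := lipN x y Nx Ny.
rewrite wE -scalerBr => h; have en (z : E) : 0 <= enorm z := sqrtr_ge0 _.
have -> : enorm (rate 0 t *: (V (sigma t) x - V (sigma t) y)) =
    rate 0 t * enorm (V (sigma t) x - V (sigma t) y).
  rewrite /enorm dotZl dotZr mulrA -expr2 sqrtrM ?sqr_ge0// sqrtr_sqr.
  by rewrite ger0_norm// rate_ge0.
rewrite /= -mulrA; apply: ler_pM => //; last exact: rate0_le.
exact: rate_ge0.
Qed.

Lemma reparam_ac : (forall s, s \in I01 -> finite_second_moment (gamma s)) ->
  ac_curve I (gamma \o sigma).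
Proof.
move=> h2; split; first by move=> t tI; exact/h2/timechange_itv.
apply: (@abs_continuous_lipschitz _ _ _ (B * delta)) => s t sI tI st.
apply: le_trans (hW (timechange_itv sI) (timechange_itv tI) (timechange_homo st)) _.
by rewrite lee_fin mulrAC ler_wpM2r// timechange_lipschitz.
Qed.

(** The exceptional set of [velocity_transport] depends on r; [ae_swap] yields one set of starting
    points good for almost all r. The time change rho is built in because preimages of null sets of
    times under a partly constant rho need not be null. *)
Lemma ae_velocity_transport s (rho : R -> R) : s \in I01 ->
  measurable_fun setT rho -> (forall r, rho r \in I01) ->
  \forall x \ae gamma s, \forall r \ae leb, V (rho r) (X s (rho r) x) = V s x.
Proof.
move=> sI mrho rhoI.
pose u (z : E * R) := V (rho z.2) (X s (rho z.2) z.1) - V s z.1.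
have mr : measurable_fun setT (fun z : E * R => rho z.2).
  exact: measurableT_comp measurable_snd.
have mVs := velocity_measurable hT sI.
have mu_ : measurable_fun setT u.
  apply: measurable_rVB; last exact: measurableT_comp measurable_fst.
  apply: (measurable_velocity_comp hV) => //.
  by apply: (measurable_flow_comp hX) => //.
have := @ae_swap _ _ _ _ _ (gamma s) leb (fun z => dot (u z) (u z))
  (measurable_dot mu_ mu_) (fun z => dot_ge0 (u z)).
have h r : \forall x \ae gamma s, dot (u (x, r)) (u (x, r)) = 0.
  apply: filterS (velocity_transport hV hX hu delta0 hW hW1 sI (rhoI r)) => x.
  by rewrite /u/= => ->; rewrite subrr dot0l.
move=> /(_ h); apply: filterS => x; apply: filterS => r ur.
by apply/eqP; rewrite -subr_eq0; apply/eqP/dot_eq0; rewrite -/(u (x, r)) ur.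
Qed.

Lemma reparam_flow : flow_maps I (gamma \o sigma) (w 0) (fun s t => X (sigma s) (sigma t)).
Proof.
have mcs : measurable_fun setT (fun t : R => clamp (sigma t)).
  exact: (measurableT_comp (@measurable_clamp R) measurable_timechange).
split.
- move=> s sI.
  apply: (eq_measurable_fun (fun p : R * E => X (sigma s) (clamp (sigma p.1)) p.2)).
    by move=> p; rewrite inE => -[/= pI _]; rewrite clampE ?timechange_itv.
  apply: measurable_funTS; apply: (measurable_flow_comp hX) => //.
  + exact: timechange_itv.
  + by move=> p; exact: clamp_itv.
  + exact: (measurableT_comp mcs measurable_fst).
- by move=> s t sI tI; exact: (pX (timechange_itv sI) (timechange_itv tI)).
- move=> r s t rI sI tI; have [_ _ + _] := hX.
  by apply; exact: timechange_itv.
move=> s sI; have SI := timechange_itv sI.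
(* [ae1], at times sigma(r), serves the new ODE; [ae2], at plain times, serves the given one. *)
have ae1 := ae_velocity_transport SI mcs (fun r => clamp_itv _).
have ae2 := ae_velocity_transport SI (@measurable_clamp R) (@clamp_itv R).
have [_ _ _ /(_ (sigma s) SI) ode] := hX.
apply: filterS3 ae1 ae2 ode => x h1 h2 ode t tI st i.
have TI := timechange_itv tI; have ST := timechange_homo st.
have stI r : [set` Interval (BLeft s) (BRight t)] r -> r \in I.
  by rewrite /= in_itv/= => /andP[_ rt]; move: tI; rewrite !inI; exact: le_trans.
pose y := V (sigma s) x 0 i.
(* Read off from the ODE rather than from [flow_line], whose exceptional set of points depends on t:
   x is fixed here before t. *)
have XE : X (sigma s) (sigma t) x 0 i = x 0 i + (sigma t - sigma s) * y.
  have [iV ->] := ode _ TI ST i; congr (_ + _).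
  rewrite mulrC -Rintegral_cst_itv//; apply: Rintegral_ae_eq => //.
    by apply/measurable_EFinP; exact: measurable_int iV.
  apply: filterS h2 => r h2; rewrite /= in_itv/= => /andP[sr rt].
  by rewrite clampE// in h2; [rewrite h2|exact: (in_I01_between SI TI)].
have irate : leb.-integrable `[s, t] (EFin \o (fun r => rate 0 r * y)).
  apply: measurable_bounded_integrable => //.
  - by rewrite [X in (X < _)%E](lebesgue_itvcc st) ltry.
  - by apply: measurable_funTS; apply: measurable_funM => //; exact: measurable_rate.
  - exists (B * `|y|); split; first exact: num_real.
    move=> b Bb r /stI rI; apply: le_trans (ltW Bb).
    by rewrite /= normrM ler_wpM2r// ger0_norm ?rate_ge0// rate0_le.
have aeq : \forall r \ae leb, [set` Interval (BLeft s) (BRight t)] r ->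
    w 0 r (X (sigma s) (sigma r) x) 0 i = rate 0 r * y.
  apply: filterS h1 => r /= h1 rst; have rI := timechange_itv (stI r rst).
  by rewrite clampE// in h1; rewrite wE mxE h1.
have mw : measurable_fun `[s, t] (fun r => w 0 r (X (sigma s) (sigma r) x) 0 i).
  apply: measurable_rV_coord.
  apply: (eq_measurable_fun (fun r => rate 0 r *:
      V (clamp (sigma r)) (X (sigma s) (clamp (sigma r)) x))).
    by move=> r; rewrite inE => /stI rI; rewrite wE clampE ?timechange_itv.
  apply: measurable_funTS; apply: measurable_rVZ; first exact: measurable_rate.
  apply: (measurable_velocity_comp hV) => //; first by move=> r; exact: clamp_itv.
  by apply: (measurable_flow_comp hX) => // r; exact: clamp_itv.
split.
  by have := @integrable_ae_eq _ _ _ leb `[s, t]%classic _ _ (measurable_itv _) mw irate aeq.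
rewrite XE; congr (_ + _).
have mrate : measurable_fun `[s, t] (fun r => rate 0 r * y).
  by apply: measurable_funTS; apply: measurable_funM => //; exact: measurable_rate.
have -> := @Rintegral_ae_eq _ _ _ leb `[s, t]%classic _ _ (measurable_itv _) mw mrate aeq.
(* The substitution formula for the linear function G(u) = u y. *)
have <- : \int[leb]_(r in `[s, t]) (c * k.+1%:R * tpow a0 k r * cst y (c * tpow a0 k.+1 r)) =
    (sigma t - sigma s) * y.
  have dG (r : R) : is_derive r 1 (fun u : R => u * y) (cst y r).
    apply: (@quadratic_is_derive _ _ _ _ 0) => h _.
    by rewrite mulrDl addrK subrr normr0 mul0r.
  have cg : continuous (cst y : R -> R) by move=> r; exact: cvg_cst.
  by rewrite (@integral_substitution_tpow _ _ _ _ _ _ dG cg)// mulrBl.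
by apply: eq_Rintegral => r _; rewrite rate0E.
Qed.

End reparametrization.

(** * Covariant derivatives of the reparametrized velocity *)

Section covariant.
Variables (R : realType) (d : nat).
Notation E := 'rV[R]_d.
Notation leb := (@lebesgue_measure R).
Notation I01 := (Interval (BLeft (0:R)) (BRight (1:R))).

Lemma covariant_derivative_ae_eq (I : interval R) (mu : R -> probability E R)
    (X : R -> R -> E -> E) (u w w' : R -> E -> E) :
  (\forall t \ae leb, w t = w' t) ->
  covariant_derivative I mu X u w -> covariant_derivative I mu X u w'.
Proof.
by move=> ww' [hu hw]; split=> //; apply: filterS2 ww' hw => t ->.
Qed.

Variables (gamma : R -> probability E R) (V : R -> E -> E) (X : R -> R -> E -> E).
Hypothesis hchain : covariant_chain_rule I01 gamma V X.
Hypothesis hV0 : covariant_derivative I01 gamma X V (fun _ _ => 0).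
Variables (H a0 : R) (k : nat).
Hypothesis H0 : 0 < H.
Let I := Interval -oo%O (BRight (a0 + H)).
Let sigma := timechange H a0 k.

Lemma is_derive_rate j t : (j < k)%N -> t != a0 ->
  is_derive t 1 (rate H a0 k j) (rate H a0 k j.+1 t).
Proof.
move=> jk ta; rewrite /rate; set c := (H^-1) ^+ k.+1.
have kj : (k - j = (k - j.+1).+1)%N by rewrite subnSK.
rewrite kj.
have := is_deriveZ (c * ((k.+1) ^_ j.+1)%:R) (is_derive_tpow_neq (k - j.+1) ta).
rewrite [_ *: _]mulrA -mulrA => h; apply: is_derive_eq h _.
rewrite (ffactnSr k.+1 j.+1) subSS natrM kj; ring.
Qed.

(** The chain rule with f = [rate j] and zero acceleration, so that only the term f' V survives.
    Since j < k, k is positive and sigma is C^1. *)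
Lemma reparam_covariant_derivative j : (j < k)%N ->
  covariant_derivative I (gamma \o sigma) (fun s t => X (sigma s) (sigma t))
    (fun t x => rate H a0 k j t *: V (sigma t) x)
    (fun t x => rate H a0 k j.+1 t *: V (sigma t) x).
Proof.
move=> jk; have [k' kE] : exists k', k = k'.+1.
  by exists k.-1; rewrite prednK// (leq_ltn_trans _ jk).
pose c := (H^-1) ^+ k.+1.
have c0 : 0 < c by rewrite exprn_gt0// invr_gt0.
have dsigma (t : R) : is_derive t 1 sigma (c * (k.+1%:R * tpow a0 k t)).
  rewrite /sigma /timechange /c kE.
  by have := is_deriveZ ((H^-1) ^+ k'.+2) (is_derive_tpow a0 k' t).
have dsigmaE : derive1 sigma = (fun t => c * (k.+1%:R * tpow a0 k t)).
  by apply/funext => t; rewrite derive1E; exact: (@derive_val _ _ _ _ _ _ _ (dsigma t)).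
have [j' jE] : exists j', (k - j)%N = j'.+1 by exists (k - j.+1)%N; rewrite subnSK.
have := hchain.2 _ hV0 I sigma (rate H a0 k j).
have h1 t : derivable sigma t 1 := @ex_derive _ _ _ _ _ _ _ (dsigma t).
have h2 : continuous (derive1 sigma).
  rewrite dsigmaE => t; apply: cvgM; first exact: cvg_cst.
  apply: cvgM; first exact: cvg_cst.
  by rewrite kE; exact: continuous_tpow.
have h3 : {homo sigma : s t / s <= t} := timechange_homo a0 k H0.
have h4 t : t \in I -> sigma t \in I01 := @timechange_itv _ _ _ _ H0 t.
have h5 : abs_continuous_on I (fun s t => `|rate H a0 k j t - rate H a0 k j s|%:E).
  apply: (@abs_continuous_lipschitz _ _ _
    (c * ((k.+1) ^_ j.+1)%:R * (j'.+1%:R * H ^+ j'))) => s t _ tI st.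
  rewrite in_itv/= in tI.
  rewrite lee_fin /rate jE -mulrBr normrM ger0_norm ?mulr_ge0 ?(ltW c0)//.
  rewrite ger0_norm ?subr_ge0 ?tpow_homo// -[leRHS]mulrA ler_wpM2l ?mulr_ge0 ?(ltW c0)//.
  exact: tpow_lipschitz.
move=> /(_ h1 h2 h3 h4 h5); apply: covariant_derivative_ae_eq.
(* The time a0 is excluded: for j = k - 1 the function [rate j] has a corner there. *)
apply: filterS (lebesgue_ae_neq a0) => t ta; apply/funext => x.
rewrite scaler0 addr0 derive1E; congr (_ *: _).
exact: (@derive_val _ _ _ _ _ _ _ (is_derive_rate jk ta)).
Qed.

End covariant.

(** * Invariance under equality on Borel sets, and construction of the curve *)

Section same_measure.
Variables (R : realType) (d : nat).
Notation E := 'rV[R]_d.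
Implicit Types mu nu : probability E R.

Lemma L2norm_same_measure mu mu' u : same_measure mu mu' -> L2norm mu u = L2norm mu' u.
Proof.
move=> h; rewrite /L2norm !Lnorm2E; congr (_ `^ _)%E.
by apply: eq_measure_integral => A mA _; exact: h.
Qed.

Lemma W2_ge0 mu nu : (0 <= W2 mu nu)%E.
Proof. by apply: le_ereal_inf_tmp => _ [pi _ <-]; exact: Lnorm_ge0. Qed.

Lemma pushes_same_measure mu mu' nu T : same_measure mu mu' ->
  pushes mu T nu -> pushes mu' T nu.
Proof.
move=> h [mT nuE]; split=> // A mA; rewrite nuE// h//.
by rewrite -[X in measurable X]setTI; exact: mT.
Qed.

End same_measure.

Theorem lemma5 (R : realType) (d : nat)
  (cs Cs : R) (m : nat) (F : set (probability 'rV[R]_d R))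
  (mu0 : probability 'rV[R]_d R) (hF : regular_problem cs Cs m F mu0)
  (k : nat) (eps H tn : R) (heps : 0 < eps) (hH : 0 < H)
  (nu : probability 'rV[R]_d R) (hnu : F nu)
  (gamma : R -> probability 'rV[R]_d R)
  (V : R -> 'rV[R]_d -> 'rV[R]_d) (X : R -> R -> 'rV[R]_d -> 'rV[R]_d)
  (hgeo : geodesic gamma mu0 nu)
  (hreg : regular_curve `[0, 1] gamma V X)
  (hchain : covariant_chain_rule `[0, 1] gamma V X)
  (hdelta : (W2 mu0 nu <= (eps * H ^+ k.+1 / (k.+1)`!%:R)%:E)%E) :
  exists mu : R -> probability 'rV[R]_d R,
    [/\ curve_class F `]-oo, tn] k eps mu,
        (forall t, t <= tn - H -> same_measure (mu t) mu0) &
        same_measure (mu tn) nu].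
Proof.
have [a0 ->] : exists a0, tn = a0 + H by exists (tn - H); rewrite subrK.
rewrite addrK.
have [[w0 [hu _]] _] := hchain.
have [[h2 _] [hV _ _ _] hL hX] := hreg.
have [g0 g1 gW] := hgeo.
have I0 : (0 : R) \in `[0, 1] by rewrite in_itv/= lexx ler01.
have I1 : (1 : R) \in `[0, 1] by rewrite in_itv/= lexx ler01.
pose delta := fine (W2 mu0 nu).
have deltaE : W2 mu0 nu = delta%:E.
  by rewrite fineK// ge0_fin_numE ?W2_ge0//; exact: le_lt_trans hdelta (ltry _).
have delta0 : 0 <= delta by rewrite -lee_fin -deltaE W2_ge0.
have hW s t : s \in `[0, 1] -> t \in `[0, 1] -> s <= t ->
    (W2 (gamma s) (gamma t) <= ((t - s) * delta)%:E)%E.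
  by move=> sI tI st; rewrite gW// ger0_norm ?subr_ge0// deltaE -EFinM.
have hW1 : (delta%:E <= W2 (gamma 0%R) (gamma 1%R))%E.
  by rewrite gW// subr0 normr1 mul1e deltaE.
have pX s t sI tI := @flow_pushes _ _ _ _ _ hX s t sI tI.
(* [rp_geodesic] speaks of interpolations of optimal maps, so the time-one flow map must be shown to
   be one. *)
have opt : optimal_map mu0 nu (X 0 1).
  split.
    apply: (pushes_same_measure g0); have [mX h] := pX 0 1 I0 I1.
    by split=> // A mA; rewrite -h// g1.
  rewrite -(L2norm_same_measure _ g0) L2norm_sqrt.
    rewrite (sqnorm_displacement hV hX hu delta0 hW hW1) sqrtr_sqr ger0_norm//.
  exact: (displacement_sq_integrable hV hX hu delta0 hW).
have Fgamma s : s \in `[0, 1] -> F (gamma s).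
  move=> sI; apply: (rp_geodesic hF hnu opt sI); apply: (pushes_same_measure g0).
  exact: (pushes_interpolation hV hX hu delta0 hW hW1 sI).
pose sigma := timechange H a0 k.
have sigI := @timechange_itv _ H a0 k hH.
exists (gamma \o sigma); split; last 2 first.
- by move=> t ta; rewrite /= /sigma timechange_start.
- by rewrite /= /sigma timechange_end.
have acmu := reparam_ac delta0 hW a0 k hH h2.
split=> //; first by move=> t tI; exact/Fgamma/sigI.
exists (fun j t x => rate H a0 k j t *: V (sigma t) x); split.
- exact: (reparam_velocity_field hV hX hu delta0 hW hW1 a0 k hH).
- move=> k0; exists (fun s t => X (sigma s) (sigma t)); split.
    split=> //.
    + exact: (reparam_velocity_field hV hX hu delta0 hW hW1 a0 k hH).
    + exact: (reparam_lipschitz hV hX hu delta0 hW hW1 a0 k hH hL).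
    + exact: (reparam_flow hV hX hu delta0 hW hW1 a0 k hH).
  move=> j jk; apply: reparam_covariant_derivative => //.
  exact: (covariant_derivative_velocity hV hX hu delta0 hW hW1).
(* Outside the time interval the restricted function takes the default value 0, which is below
   eps. *)
apply/ess_supP/aeW => t; rewrite patchE; case: ifPn => [|_]; last first.
  by rewrite lee_fin ltW.
rewrite inE/= => tI.
have -> := @L2norm_rate _ _ _ _ _ hV hX hu _ delta0 hW hW1 _ _ _ hH k t tI.
rewrite lee_fin; have := hdelta; rewrite deltaE lee_fin => hd.
have f0 : 0 < (k.+1)`!%:R :> R by rewrite ltr0n fact_gt0.
(* The bound of [rate_last] times the assumed bound on the distance; the product is exactly eps. *)
apply: (@le_trans _ _ ((H^-1) ^+ k.+1 * (k.+1)`!%:R * (eps * H ^+ k.+1 / (k.+1)`!%:R))).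
  by apply: ler_pM => //; [exact: rate_ge0|exact: rate_last].
by rewrite exprVn le_eqVlt; apply/orP; left; apply/eqP; field; rewrite !gt_eqF ?exprn_gt0.
Qed.
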